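(* Suppose that for any $i\in\mathcal N$ the virtual cost $\psi_i(c)=c+\frac{F_i(c)}{f_i(c)}$ is increasing in $c$. For any reported vector of privacy sensitivities $\mathbf c=(c_1,\dots,c_n)$, the optimal privacy loss level in the central privacy data acquisition mechanism (with linear estimators, as defined in the context) is $\varepsilon_i^*(\mathbf c)=y_i^*$ for $i\in\mathcal N$, where $(y_1^*,\dots,y_n^* )$ is the optimal solution of $$\min_{\mathbf y}\ \frac{n+1}{\left(\sum_{j=1}^n y_j\right)^2}\Big(2+\sum_{i=1}^n y_i^2\,\mathrm{VAR}\Big)+\sum_{i=1}^n\psi_i(c_i)\,y_i\qquad\text{s.t. } y_i\ge0\ \text{ for all } i\in\mathcal N.$$ Moreover, for all $i\in\mathcal N$, the weight of user $i$'s data in the platform's estimator is $\frac{y_i^*}{\sum_{j=1}^n y_j^*}$.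
   Context: Setting. $\mathcal{N}=\{1,\dots,n\}$; $\theta\in\mathbb{R}$ is an underlying parameter to be estimated; user $i$ holds data $X_i=\theta+Z_i$ with $Z_1,\dots,Z_n$ i.i.d., mean zero, variance $\mathrm{VAR}$, $|Z_i|\le\frac12$. User $i$ has a privately known privacy sensitivity $c_i\in\mathbb{R}_+$ (nonnegative reals), drawn independently across users, and independently of the data, from a publicly known distribution with CDF $F_i$ and density $f_i$; $\psi_i$ is defined on the support $\{c\in\mathbb R_+:f_i(c)\ne0\}$. Write $\mathbf c=(c_1,\dots,c_n)$, $\mathbf c_{-i}=(c_j)_{j\ne i}$. Mechanism in the central setting. Users report sensitivities and share data. For each $i$, $\varepsilon_i:\mathbb R_+^n\to\mathbb R_+$ and $t_i:\mathbb R_+^n\to\mathbb R_+$ map the reported sensitivities to a privacy loss of, and a payment to, user $i$; the functions defining a mechanism are assumed differentiable with Riemann integrable derivatives. The platform uses the linear estimator $$\hat\theta_{\mathrm{central}}(x_1,\dots,x_n)=\sum_{i=1}^n w_i(\mathbf c)\,x_i+\mathrm{Laplace}(1/\eta),\qquad \sum_{i=1}^n w_i(\mathbf c)=1,\qquad \eta\, w_i(\mathbf c)\le\varepsilon_i(\mathbf c)\ \text{ for all } i\in\mathcal N,$$ where $\mathrm{Laplace}(b)$ is independent noise with density $\frac1{2b}e^{-|z|/b}$; the weights and $\eta$ are also chosen by the platform given the reported $\mathbf c$. The last constraint ensures that the estimator is centrally differentially private with losses $\varepsilon_i(\mathbf c)$: changing only user $i$'s data changes the probability of any output event by a factor of at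 most $e^{\varepsilon_i(\mathbf c)}$. Platform's problem. Let $\mathrm{MSE}(\mathbf c)=\mathbb E[|\hat\theta_{\mathrm{central}}-\theta|^2]$ be the mean squared error given reports $\mathbf c$. The cost of user $i$ with sensitivity $c_i$ who reports $c_i'$ is $$\mathrm{COST}_i(c_i',c_i)=\mathbb E_{\mathbf c_{-i}}\left[\mathrm{MSE}(c_i',\mathbf c_{-i})+c_i\,\varepsilon_i(c_i',\mathbf c_{-i})-t_i(c_i',\mathbf c_{-i})\right].$$ The optimal mechanism minimizes $\mathbb E_{\mathbf c}\left[\mathrm{MSE}(\mathbf c)+\sum_{i=1}^n t_i(\mathbf c)\right]$ subject to incentive compatibility, $\mathrm{COST}_i(c_i,c_i)\le\mathrm{COST}_i(c_i',c_i)$ for all $i\in\mathcal N$, $c_i,c_i'$, and individual rationality, $\mathrm{COST}_i(c_i,c_i)\le\mathrm{VAR}$ for all $i\in\mathcal N$, $c_i$.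
   Formalization: Payments may be negative and mechanisms are measurable with integrable payments, not differentiable (subclasses must not change the optimal value); supports are intervals; a feasible mechanism and measurable program solutions on the supports are assumed; uniqueness is almost sure. *)

(* Defs.v *)
From mathcomp Require Import all_boot all_order all_algebra.
From mathcomp Require Import all_classical all_reals all_analysis.
Set Implicit Arguments.
Unset Strict Implicit.
Unset Printing Implicit Defensive.
Import Order.TTheory GRing.Theory Num.Theory.
Import numFieldNormedType.Exports.
Local Open Scope classical_set_scope.
Local Open Scope ring_scope.

Section profiles.
Context {R : realType} {n : nat}.
Implicit Types (c : n.-tuple R) (i : 'I_n).

Definition orthant : set (n.-tuple R) := [set c | forall i, 0 <= tnth c i].

(* the profile (x, c_{-i}) *)
Definition replace c i (x : R) : n.-tuple R :=
  [tuple if j == i then x else tnth c j | j < n].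

End profiles.

Section program.
Context {R : realType} {n : nat}.
Implicit Types (p y z : n.-tuple R).

Definition program_cost (VAR : R) p y : R :=
  n.+1%:R / (\sum_(j < n) tnth y j) ^+ 2 *
    (2 + \sum_(i < n) tnth y i ^+ 2 * VAR)
  + \sum_(i < n) tnth p i * tnth y i.

(* The point y = 0, where the cost is +oo, has to be excluded by hand because
   x / 0 = 0 in MathComp. *)
Definition program_dom : set (n.-tuple R) :=
  [set y | orthant y /\ 0 < \sum_(j < n) tnth y j].

Definition is_solution (VAR : R) p y :=
  program_dom y /\
  forall z, program_dom z -> program_cost VAR p y <= program_cost VAR p z.

End program.

(* Only the values on [orthant] are meaningful. *)
Record mechanism (R : realType) (n : nat) := Mechanism {
  loss : n.-tuple R -> n.-tuple R ;
  payment : n.-tuple R -> n.-tuple R ;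
  weight : n.-tuple R -> n.-tuple R ;
  noise : n.-tuple R -> R }.

Definition laplace_pdf {R : realType} (b z : R) : R :=
  (2 * b)^-1 * expR (- (`|z| / b)).

(* Independence of the whole family; taking some A i := setT gives the product
   rule for every subfamily. *)
Definition mutually_independent {d} {T : measurableType d} {R : realType}
    (P : probability T R) {I : finType} (X : I -> T -> R) :=
  forall A : I -> set R, (forall i, measurable (A i)) ->
    P [set w | forall i, A i (X i w)] = (\prod_(i : I) P (X i @^-1` A i))%E.

Definition has_density {d} {T : measurableType d} {R : realType}
    (P : probability T R) (X : {RV P >-> R}) (f : R -> R) :=
  [/\ measurable_fun setT f, forall x, 0 <= f x &
      forall A : set R, measurable A ->
        distribution P X A = (\int[lebesgue_measure]_(x in A) (f x)%:E)%E].

Arguments has_density {d T R} P X f.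

Definition support_of {R : realType} (f : R -> R) : set R :=
  [set x | 0 <= x /\ f x != 0].

Definition virtual_cost {d} {T : measurableType d} {R : realType}
    (P : probability T R) (X : {RV P >-> R}) (f : R -> R) (x : R) : R :=
  x + fine (cdf (P := P) X x) / f x.
Arguments virtual_cost {d T R} P X f x.

Section platform.
Context {d : measure_display} {T : measurableType d} {R : realType}
  (P : probability T R) {n : nat} (theta VAR : R)
  (Z C : 'I_n -> {RV P >-> R}) (f : 'I_n -> R -> R).
Implicit Types (M : mechanism R n) (c : n.-tuple R) (i : 'I_n).

(* E|estimate - theta|^2 at fixed reports c: outer integral over the data,
   inner one over the independent noise Laplace(1 / noise M c). *)
Definition MSE M c : R := fine
  (\int[P]_w \int[lebesgue_measure]_z
     (`| (\sum_(i < n) tnth (weight M c) i * (theta + Z i w) + z) - theta | ^+ 2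
      * laplace_pdf (noise M c)^-1 z)%:E)%E.

Definition sensitivities (w : T) : n.-tuple R := [tuple C i w | i < n].

(* sensitivity x, report x' *)
Definition COST M i (x' x : R) : \bar R := 'E_P[(fun w : T =>
  let c := replace (sensitivities w) i x' in
  MSE M c + x * tnth (loss M c) i - tnth (payment M c) i)%R]%E.

Definition platform_cost M : \bar R := 'E_P[(fun w : T =>
  let c := sensitivities w in
  MSE M c + \sum_(i < n) tnth (payment M c) i)%R]%E.

(* Integrability of the payments makes COST and platform_cost well defined in
   ]-oo, +oo]: all the other terms are nonnegative. *)
Definition is_mechanism M :=
  [/\ [/\ measurable_fun orthant (loss M), measurable_fun orthant (payment M),
          measurable_fun orthant (weight M) & measurable_fun orthant (noise M)],
      forall c, orthant c ->
        [/\ orthant (loss M c), \sum_(i < n) tnth (weight M c) i = 1,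
            0 < noise M c &
            forall i, noise M c * tnth (weight M c) i <= tnth (loss M c) i],
      forall i, P.-integrable setT
        (fun w => (tnth (payment M (sensitivities w)) i)%:E) &
      forall i x, 0 <= x -> P.-integrable setT
        (fun w => (tnth (payment M (replace (sensitivities w) i x)) i)%:E)].

(* True sensitivities range over the support, reports over R_+. *)
Definition incentive_compatible M :=
  forall i x x', support_of (f i) x -> 0 <= x' ->
    (COST M i x x <= COST M i x' x)%E.

Definition individually_rational M :=
  forall i x, support_of (f i) x -> (COST M i x x <= VAR%:E)%E.

Definition feasible M :=
  [/\ is_mechanism M, incentive_compatible M & individually_rational M].

(* K collects further requirements on the mechanism (e.g. nonnegative payments,
   smoothness); K = setT is the unrestricted problem. *)
Definition optimal_in (K : set (mechanism R n)) M :=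
  [/\ feasible M, K M &
      forall M', feasible M' -> K M' -> (platform_cost M <= platform_cost M')%E].

(* Imposing K does not change the value of the problem. *)
Definition lossless (K : set (mechanism R n)) :=
  forall M (e : R), feasible M -> 0 < e ->
    exists M', [/\ feasible M', K M' &
                   (platform_cost M' <= platform_cost M + e%:E)%E].

Definition supports : set (n.-tuple R) :=
  [set c | forall i, support_of (f i) (tnth c i)].

Definition virtual_costs c : n.-tuple R :=
  [tuple virtual_cost P (C i) (f i) (tnth c i) | i < n].

End platform.

Arguments MSE {d T R} P {n} theta Z M c.
Arguments COST {d T R} P {n} theta Z C M i x' x.
Arguments feasible {d T R} P {n} theta VAR Z C f M.
Arguments optimal_in {d T R} P {n} theta VAR Z C f K M.
Arguments lossless {d T R} P {n} theta VAR Z C f K.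
Arguments virtual_costs {d T R} P {n} C f c.
Arguments sensitivities {d T R P n} C w.

(* Main.v *)
Require Import Defs.
From HB Require Import structures.
From mathcomp Require Import all_boot all_order all_algebra.
From mathcomp Require Import all_classical all_reals all_analysis.
From mathcomp Require Import measurable_realfun ring lra.
Set Implicit Arguments.
Unset Strict Implicit.
Unset Printing Implicit Defensive.
Import Order.TTheory GRing.Theory Num.Theory.
Import numFieldNormedType.Exports.
Local Open Scope classical_set_scope.
Local Open Scope ring_scope.

(* Screening argument: write [E_i(x)] for the expected loss of user [i] when
   reporting [x]. Incentive compatibility makes the cost [h_i(x)] of a truthful
   user concave with slope [E_i], so individual rationality at the top of the
   support gives [h_i(x) <= VAR - \int_x E_i]. Integrating this information
   rent against the law of [C_i] and exchanging the integrals yields the hazard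
   term [F_i / f_i], hence every feasible mechanism costs at least
   [E((n + 1) MSE(C) + \sum_i psi_i(C_i) eps_i(C)) - n VAR]. As
   [MSE = VAR \sum_i w_i^2 + 2 / eta^2], the integrand is pointwise at least the
   value of the program, with [y_i = max(eta w_i, 0)]. Conversely the pointwise
   minimizer is nonincreasing in [c_i] because [psi_i] is nondecreasing, so it is
   implemented by payments leaving exactly the information rent to each user.
   Equality in the pointwise bound, with [psi_i(c_i) > 0], forces
   [eps_i = eta w_i], which identifies losses and weights. *)

(** The factor [n + 1] counts copies of the mean squared error: one is the platform's own, and the
    payment to each user has to offset the copy in that user's cost. The obstacle is integrability.
    Interim costs may be infinite and payments have no sign, so integrals are arranged as sums of
    nonnegative terms, to which Tonelli applies. The delicate point is sensitivity 0: the optimal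
    loss may be unbounded as the virtual cost vanishes, while incentive compatibility concerns every
    point of the support, including 0, and not only almost every one. Comparing a solution [y] with
    [y / 2] bounds [p_i * y_i ^+ 3], hence the interim loss at [s] by a constant times [s^(-1/2)]
    near 0. This is integrable, so the information rent is finite on the whole support. All other
    integrability for the optimal mechanism comes from the finite expected value of the program,
    which any feasible mechanism guarantees. *)

Lemma measurable_funV {d : measure_display} {T : measurableType d} {R : realType}
    (D : set T) (g : T -> R) :
  measurable_fun D g -> measurable_fun D (fun x => (g x)^-1).
Proof.
move=> mg.
(* Squaring makes the base nonnegative, where [powR] at exponent -1 is the inverse; the factor [g x]
   restores the sign and gives 0 where [g x = 0], in agreement with [0^-1 = 0]. *)
rewrite (_ : (fun _ => _) = fun x => g x * (g x ^+ 2) `^ (-1)).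
  apply: measurable_funM => //.
  by apply: (measurableT_comp (measurable_powR _)); exact: measurable_funX.
apply/funext => x; rewrite powR_inv1 ?sqr_ge0// expr2.
have [->|gx0] := eqVneq (g x) 0; first by rewrite invr0 mul0r.
by rewrite invfM mulrA divff// mul1r.
Qed.

(** * Measurability of maps into profiles *)

Section tuple_measurability.
Context {d : measure_display} {T : measurableType d} {R : realType} {n : nat}.
Implicit Types (D : set T) (c : n.-tuple R).

Lemma measurable_fun_tuple (f : T -> n.-tuple R) :
  (forall i, measurable_fun setT (fun w => tnth (f w) i)) ->
  measurable_fun setT f.
Proof. by move=> mf; apply/measurable_fun_tnthP => i; exact: mf. Qed.

Lemma measurable_fun_replace i (f : T -> n.-tuple R) (g : T -> R) :
  measurable_fun setT f -> measurable_fun setT g ->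
  measurable_fun setT (fun w => replace (f w) i (g w)).
Proof.
move=> mf mg; apply: measurable_fun_tuple => j.
under eq_fun do rewrite tnth_mktuple.
case: (j == i) => //.
by apply: (measurableT_comp (measurable_tnth j)).
Qed.

Lemma tnth_replace c i x j :
  tnth (replace c i x) j = if j == i then x else tnth c j.
Proof. by rewrite tnth_mktuple. Qed.

Lemma measurable_box (A : 'I_n -> set R) : (forall i, measurable (A i)) ->
  measurable [set c : n.-tuple R | forall i, A i (tnth c i)].
Proof.
move=> mA.
rewrite (_ : [set _ | _] = \bigcap_(i : 'I_n) ((@tnth n R ^~ i) @^-1` A i));
  last by apply/seteqP; split => [c h i _|c h i]; [exact: h|exact: (h i I)].
apply: fin_bigcap_measurable => // i _.
by rewrite -[X in measurable X]setTI; exact: measurable_tnth.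
Qed.

End tuple_measurability.

(** * Resampling one coordinate of an independent profile *)

Section resampling.
Context {d : measure_display} {T : measurableType d} {R : realType}
  (P : probability T R) {n : nat} (X : 'I_n -> {RV P >-> R}).
Hypothesis indepX : mutually_independent P (fun i => X i : T -> R).
Implicit Types (i : 'I_n) (g : n.-tuple R -> \bar R).

Lemma measurable_sensitivities : measurable_fun setT (sensitivities X).
Proof.
apply: measurable_fun_tuple => i.
rewrite (_ : (fun w => _) = X i) //.
by apply/funext => w; rewrite tnth_mktuple.
Qed.

(** A generating pi-system: independence gives the probability of a box as a product, and two finite
    measures that agree on boxes are equal. *)
Let boxes := [set B : set (n.-tuple R) | exists2 A : 'I_n -> set R,
  forall i, measurable (A i) & B = [set c | forall i, A i (tnth c i)]].

Let boxesE : measurable = <<s boxes >>.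
Proof.
apply/seteqP; split; last first.
  apply: smallest_sub; first exact: sigma_algebra_measurable.
  by move=> _ [A mA ->]; exact: measurable_box.
apply: smallest_sub; first exact: smallest_sigma_algebra.
rewrite -bigcup_seq => B [i _ [A mA <-]]; apply: sub_sigma_algebra.
exists (fun j => if j == i then A else setT).
  by move=> j; case: ifP.
apply/seteqP; split => c /=.
  by move=> [_ Ac] j; case: eqP => // ->.
by move=> /(_ i); rewrite eqxx.
Qed.

Let setI_boxes : setI_closed boxes.
Proof.
move=> _ _ [A mA ->] [B mB ->]; exists (fun i => A i `&` B i).
  by move=> i; exact: measurableI.
apply/seteqP; split => c /=; first by move=> [Ac Bc] i; split.
by move=> ABc; split => i; have [] := ABc i.
Qed.

Lemma measure_resample i (A : set (n.-tuple R)) : measurable A ->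
  P (sensitivities X @^-1` A) =
  (distribution P (X i) \x P)%E ((fun p => replace (sensitivities X p.2) i p.1) @^-1` A).
Proof.
move=> mA.
have mr : measurable_fun setT
    (fun p : R * T => replace (sensitivities X p.2) i p.1).
  apply: measurable_fun_replace => //.
  exact: (measurableT_comp measurable_sensitivities).
pose s : {mfun T >-> n.-tuple R} :=
  HB.pack (sensitivities X) (isMeasurableFun.Build _ _ _ _ _ measurable_sensitivities).
pose r : {mfun _ >-> n.-tuple R} :=
  HB.pack (fun p : R * T => replace (sensitivities X p.2) i p.1) (isMeasurableFun.Build _ _ _ _ _ mr).
apply: (@measure_unique _ R _ boxes (fun=> setT) boxesE setI_boxes _ _
  (pushforward P s) (pushforward (distribution P (X i) \x P)%E r)) => //.
- by move=> _; exists (fun=> setT) => //; apply/seteqP; split.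
- by rewrite bigcup_const.
- move=> _ [B mB ->]; rewrite /pushforward.
  transitivity (\prod_j P (X j @^-1` B j))%E.
    rewrite -indepX//; congr (P _); apply/seteqP; split => w /= h j;
    by have := h j; rewrite tnth_mktuple.
  (* Opening the [i]-th side separates the fresh coordinate from those read at [w], so that the
     preimage of the box is a measurable rectangle. *)
  pose Bi j := if j == i then setT else B j.
  have mBi j : measurable (Bi j) by rewrite /Bi; case: ifP.
  transitivity ((distribution P (X i) \x P)%E
      (B i `*` [set w | forall j, Bi j (X j w)])); last first.
    congr ((_ \x _)%E _); apply/seteqP; split => -[x w] /=.
      move=> [Bx h] j; rewrite tnth_replace; case: eqP => [->//|/eqP/negbTE ji].
      by have := h j; rewrite /Bi ji tnth_mktuple.
    move=> h; split => [|j]; first by have := h i; rewrite tnth_replace eqxx.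
    rewrite /Bi; case: eqP => // /eqP/negbTE ji.
    by have := h j; rewrite tnth_replace ji tnth_mktuple.
  rewrite product_measure1E//; last first.
    rewrite (_ : [set _ | _] =
        sensitivities X @^-1` [set c | forall j, Bi j (tnth c j)]); last first.
      by apply/seteqP; split => w /= h j; have := h j; rewrite tnth_mktuple.
    rewrite -[X in measurable X]setTI; apply: measurable_sensitivities => //.
    exact: measurable_box.
  transitivity (P (X i @^-1` B i) * \prod_j P (X j @^-1` Bi j))%E; last first.
    by congr (_ * _)%E; apply/esym; exact: indepX.
  rewrite (bigD1 i)//= [in RHS](bigD1 i)//=.
  rewrite {1}/Bi eqxx preimage_setT probability_setT mul1e.
  by congr (_ * _)%E; apply: eq_bigr => j /negbTE ji; rewrite /Bi ji.
- move=> _; apply: (le_lt_trans (probability_le1 _ _)); rewrite ?ltry//.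
  by rewrite -[X in measurable X]setTI; exact: measurable_sensitivities.
Qed.

(* Independence makes [(x, C_{-i})], with [x] a fresh copy of [C_i], equal in
   law to [C]; this is how interim expectations given [C_i] are handled. *)
Lemma ge0_integral_resample i g : measurable_fun setT g -> (forall c, 0 <= g c)%E ->
  (\int[P]_w g (sensitivities X w) =
   \int[distribution P (X i)]_x \int[P]_w g (replace (sensitivities X w) i x))%E.
Proof.
move=> mg g0.
have mr : measurable_fun setT
    (fun p : R * T => replace (sensitivities X p.2) i p.1).
  apply: measurable_fun_replace => //.
  exact: (measurableT_comp measurable_sensitivities).
pose s : {mfun T >-> n.-tuple R} :=
  HB.pack (sensitivities X) (isMeasurableFun.Build _ _ _ _ _ measurable_sensitivities).
pose r : {mfun _ >-> n.-tuple R} :=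
  HB.pack (fun p : R * T => replace (sensitivities X p.2) i p.1) (isMeasurableFun.Build _ _ _ _ _ mr).
rewrite -(fubini_tonelli1 (g \o r)); [|exact: measurableT_comp|by move=> p; exact: g0].
transitivity (\int[pushforward P s]_c g c)%E.
  by rewrite ge0_integral_pushforward.
transitivity (\int[pushforward (distribution P (X i) \x P)%E r]_c g c)%E; last first.
  by rewrite ge0_integral_pushforward.
apply: eq_measure_integral => A mA _; exact: measure_resample.
Qed.

Lemma measurable_resample i g : measurable_fun setT g -> (forall c, 0 <= g c)%E ->
  measurable_fun setT (fun x => \int[P]_w g (replace (sensitivities X w) i x))%E.
Proof.
move=> mg g0.
apply: (measurable_fun_fubini_tonelli_F
  (fun p : R * T => g (replace (sensitivities X p.2) i p.1))) => //.
apply: measurableT_comp => //.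
apply: measurable_fun_replace => //.
exact: (measurableT_comp measurable_sensitivities).
Qed.

End resampling.

(** * Subtracting an integrable function from a nonnegative one *)

Section one_sided_integrability.
Context {d : measure_display} {T : measurableType d} {R : realType}
  (mu : {measure set T -> \bar R}).
Implicit Types u v : T -> R.

Lemma ge0_integralB_EFin u v :
  measurable_fun setT u -> (forall w, 0 <= u w) ->
  mu.-integrable setT (EFin \o v) ->
  (\int[mu]_w (u w - v w)%:E = \int[mu]_w (u w)%:E - \int[mu]_w (v w)%:E)%E.
Proof.
move=> mu_ u0 iv.
have mv : measurable_fun setT v by exact/measurable_EFinP/(measurable_int _ iv).
have [iu|] := ltP (\int[mu]_w (u w)%:E)%E +oo%E.
  rewrite integralB_EFin//; apply/integrableP; split; first exact/measurable_EFinP.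
  by under eq_integral do rewrite /= ger0_norm//.
rewrite leye_eq => /eqP uoo.
have fv : (\int[mu]_w (v w)%:E)%E \is a fin_num by exact: integrable_fin_num.
have [_ avoo] := integrableP _ _ _ iv.
rewrite uoo addye; last by move: fv; rewrite fin_numE => /andP[? ?]; rewrite eqe_oppLR.
have m1 : measurable_fun setT (fun w => u w - v w) by exact: measurable_funB.
pose f := fun w => (u w - v w)%:E.
have mf : measurable_fun setT f by exact/measurable_EFinP.
rewrite -[LHS]/(\int[mu]_w f w)%E integralE.
have -> : (\int[mu]_w f^\+ w = +oo)%E.
  apply/eqP; rewrite -leye_eq leNgt; apply/negP => foo.
  have := lte_add_pinfty foo avoo.
  rewrite -ge0_integralD//; last 2 first.
  - exact: measurable_funepos.
  - by apply: measurableT_comp => //; exact/measurable_EFinP.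
  rewrite ltNge => /negP; apply; rewrite -uoo.
  apply: ge0_le_integral => //.
  - by move=> w _; rewrite lee_fin.
  - exact/measurable_EFinP.
  - apply: emeasurable_funD; first exact: measurable_funepos.
    by apply: measurableT_comp => //; exact/measurable_EFinP.
  - move=> w _ /=; rewrite funeposE -EFin_max -EFinD lee_fin.
    have := ler_norm (v w); have : u w - v w <= Num.max (u w - v w) 0 by rewrite le_max lexx.
    lra.
rewrite addye//.
suff: (\int[mu]_w f^\- w < +oo)%E.
  by move=> h; rewrite eqe_oppLR/= lt_eqF.
apply: le_lt_trans avoo; apply: ge0_le_integral => //.
- exact: measurable_funeneg.
- by apply: measurableT_comp => //; exact/measurable_EFinP.
- move=> w _ /=; rewrite funenegE -EFinN -EFin_max lee_fin ge_max normr_ge0 andbT.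
  by have := u0 w; have := ler_norm (v w); lra.
Qed.

End one_sided_integrability.

(** * Densities and the expected information rent *)

Section density.
Context {d : measure_display} {T : measurableType d} {R : realType}
  (P : probability T R) (X : {RV P >-> R}) (f : R -> R).
Hypothesis Xf : has_density P X f.
Local Notation mu := (@lebesgue_measure R).
Local Notation nu := (distribution P X).
Implicit Types g : R -> \bar R.

Let mf : measurable_fun setT f. Proof. by case: Xf. Qed.
Let f0 x : 0 <= f x. Proof. by case: Xf. Qed.

Lemma density_integralE A : measurable A ->
  (nu A = \int[mu]_(x in A) (f x)%:E)%E.
Proof. by case: Xf => _ _; apply. Qed.

Lemma density_set1 x : nu [set x] = 0%E.
Proof.
rewrite density_integralE//; apply: null_set_integral => //.
  by apply/measurable_EFinP; exact: measurable_funTS.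
exact: lebesgue_measure_set1.
Qed.

(** [f] has the same integral as the Radon-Nikodym derivative of the law on every measurable set, so
    the two agree almost everywhere. *)
Lemma ge0_integral_density g : measurable_fun setT g -> (forall x, 0 <= g x)%E ->
  (\int[nu]_x g x = \int[mu]_x (g x * (f x)%:E))%E.
Proof.
move=> mg g0.
(* [R] and [measurableTypeR R] carry the same sigma-algebra under different
   displays; Radon-Nikodym needs both measures on the latter. *)
have mX : measurable_fun setT (X : T -> measurableTypeR R).
  exact: (@measurable_funPT _ _ _ _ X).
pose Y : {mfun T >-> measurableTypeR R} :=
  HB.pack (X : T -> measurableTypeR R) (isMeasurableFun.Build _ _ _ _ _ mX).
pose nuY : {finite_measure set (measurableTypeR R) -> \bar R} := distribution P Y.
have domY : nuY `<< mu.
  apply/null_content_dominatesP => A mA A0.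
  rewrite /nuY/= -[LHS]/(nu A) density_integralE//.
  apply: null_set_integral => //.
  by apply/measurable_EFinP; exact: measurable_funTS.
transitivity (\int[nuY]_x g x)%E; first by rewrite !ge0_integral_distribution.
rewrite -(Radon_Nikodym_SigmaFinite.change_of_variables domY g0)//.
have mef : measurable_fun setT (EFin \o f) by exact/measurable_EFinP.
have iRN := Radon_Nikodym_SigmaFinite.f_integrable domY.
apply: ae_eq_integral => //.
- by apply: emeasurable_funM => //; exact: measurable_int iRN.
- exact: emeasurable_funM.
apply: ae_eqe_mul2l; apply: integral_ae_eq => // A _ mA.
by rewrite -Radon_Nikodym_SigmaFinite.f_integral// -density_integralE.
Qed.

Lemma measurable_support_of : measurable (support_of f).
Proof.
rewrite (_ : support_of f = `[0, +oo[ `&` ~` (f @^-1` [set 0])).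
  apply: measurableI => //; apply: measurableC.
  by rewrite -[X in measurable X]setTI; exact: mf.
apply/seteqP; split => x /=; rewrite in_itv/= andbT.
  by move=> [x0 /eqP].
by move=> [x0 /eqP].
Qed.

(** What a user of sensitivity [x] gains over the outside option when [e] is the interim loss: a
    truthful cost of slope [e] accumulated over all higher sensitivities in the support. *)
Definition rent (e : R -> \bar R) (x : R) : \bar R :=
  (\int[mu]_(s in support_of f `&` `[x, +oo[) e s)%E.

Let GR := measurableTypeR R.

(** Turning the domain of integration into a kernel, jointly measurable in [x] and [s], makes the
    double integral accessible to Tonelli. *)
Let k (x s : R) : R := \1_(support_of f) s * (x <= s)%R%:R.

Let rentE e x :
  (rent e x = \int[mu]_s ((k x s)%:E * e s))%E.
Proof.
rewrite /rent integral_mkcond; apply: eq_integral => s _.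
rewrite patchE in_setI.
have -> : (s \in `[x, +oo[%classic) = (x <= s) by rewrite mem_setE in_itv/= andbT.
by rewrite /k indicE; case: (s \in _) => /=; case: (x <= s); rewrite ?mulr1 ?mulr0 ?mul0r ?mul1e ?mul0e.
Qed.

Let measurable_rent_fun e : measurable_fun setT e ->
  measurable_fun setT (fun p : R * GR =>
    (k p.1 p.2)%:E * e p.2)%E.
Proof.
move=> me; apply: emeasurable_funM; last exact: (measurableT_comp me).
apply/measurable_EFinP; apply: measurable_funM.
  apply: measurableT_comp; last exact: measurable_snd.
  by apply: measurable_indic; exact: measurable_support_of.
rewrite (_ : (fun _ => _) = \1_[set p : R * GR | p.1 <= p.2]); last first.
  by apply/funext => p; rewrite indicE mem_setE.
apply: measurable_indic.
rewrite (_ : [set _ | _] = (fun p : R * GR => p.1 <= p.2) @^-1` [set true])//.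
rewrite -[X in measurable X]setTI.
by apply: (measurable_fun_ler measurable_fst measurable_snd).
Qed.

Let rent_fun_ge0 e x s : (forall s, 0 <= e s)%E ->
  (0 <= (k x s)%:E * e s)%E.
Proof. by move=> e0; rewrite mule_ge0// lee_fin mulr_ge0. Qed.

Lemma measurable_rent e : measurable_fun setT e -> (forall s, 0 <= e s)%E ->
  measurable_fun setT (rent e).
Proof.
move=> me e0; rewrite (funext (rentE e)).
apply: (measurable_fun_fubini_tonelli_F (fun p : R * GR =>
    (k p.1 p.2)%:E * e p.2)%E).
  exact: measurable_rent_fun.
by move=> p; exact: rent_fun_ge0.
Qed.

(* Exchanging the integrals over the type [x] and over [s >= x] produces the
   term [F / f] of the virtual cost. *)
Lemma integral_rent e : measurable_fun setT e -> (forall s, 0 <= e s)%E ->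
  (\int[nu]_x rent e x = \int[nu]_s
    ((\1_(support_of f) s * (fine (cdf (P := P) X s) / f s) : R)%:E * e s))%E.
Proof.
move=> me e0.
transitivity (\int[nu]_x \int[mu]_s
    ((k x s)%:E * e s))%E.
  by apply: eq_integral => x _; exact: rentE.
rewrite (fubini_tonelli (fun p : R * GR =>
    (k p.1 p.2)%:E * e p.2)%E); last 2 first.
- exact: measurable_rent_fun.
- by move=> p; exact: rent_fun_ge0.
rewrite ge0_integral_density; last 2 first.
- apply: emeasurable_funM => //; apply/measurable_EFinP/measurable_funM.
    by apply: measurable_indic; exact: measurable_support_of.
  apply: measurable_funM; last exact: measurable_funV.
  by apply: measurableT_comp => //; exact: cdf_measurable.
- move=> s; rewrite mule_ge0// lee_fin mulr_ge0// divr_ge0//.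
  by rewrite fine_ge0// cdf_ge0.
apply: eq_integral => s _ /=.
have m1 : measurable_fun setT (fun x : R => (x <= s)%R%:R : R).
  rewrite (_ : (fun _ => _) = \1_(`]-oo, s]%classic)); first exact: measurable_indic.
  by apply/funext => x; rewrite indicE mem_setE in_itv.
rewrite ge0_integralZr//; last 2 first.
- by apply: measurableT_comp => //; exact: measurable_funM.
- by move=> x _; rewrite lee_fin mulr_ge0.
under eq_integral do rewrite /k EFinM.
rewrite ge0_integralZl//; last exact/measurable_EFinP.
have -> : (\int[nu]_x ((x <= s)%R%:R)%:E = cdf (P := P) X s)%E.
  rewrite /cdf -[X in nu X]setIT -integral_indic//.
  by apply: eq_integral => x _; rewrite indicE mem_setE in_itv.
(* The density of the outer law cancels the division by [f s], nonzero on the support; off the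
   support the indicator annihilates both sides. *)
rewrite -[cdf X s in LHS]fineK ?fin_num_measure// -EFinM [RHS]muleAC -EFinM.
rewrite indicE; have [|_] := boolP (s \in _); last by rewrite !mul0r.
by rewrite inE => -[_ fs]; rewrite !mul1r divfK.
Qed.

(** The exceptional set is covered by the negative half-line, the zero set of [f] and the origin,
    each null for the law. Strict positivity serves twice: for finite interim losses, and for
    positive virtual costs in the equality case. *)
Lemma density_support (X_ge0 : forall w, 0 <= X w) :
  {ae P, forall w, 0 < X w /\ support_of f (X w)}.
Proof.
pose A := ~` (support_of f `&` ~` [set 0]).
have mA : measurable A.
  apply/measurableC/measurableI; first exact: measurable_support_of.
  exact: measurableC.
exists (X @^-1` A); split; first exact: measurable_funPTI.
- have A0 : A `<=` [set x | x < 0] `|` ([set x | f x = 0] `|` [set 0]).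
    move=> x; rewrite /A setCI setCK => -[|->]; last by right; right.
    by move=> /not_andP[/negP|/negP]; [rewrite -ltNge; left|rewrite negbK => /eqP; right; left].
  have mN : measurable [set x : R | x < 0].
    by rewrite -set_itvNyo.
  have m0 : measurable [set x | f x = 0].
    by rewrite -[X in measurable X]setTI; exact: (mf measurableT (measurable_set1 0)).
  apply/eqP; rewrite -measure_le0 -[leLHS]/(nu A).
  apply: le_trans (le_measure nu _ _ A0) _; rewrite ?inE//.
    by apply: measurableU => //; exact: measurableU.
  apply: le_trans (measureU2 nu _ _) _ => //; first exact: measurableU.
  rewrite [X in (X + _)%E](_ : _ = 0%E) ?add0e; last first.
    transitivity (P set0); last exact: measure0.
    congr (P _); by apply/seteqP; split => // w /=; rewrite ltNge X_ge0.
  apply: le_trans (measureU2 nu _ _) _ => //.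
  rewrite [X in (X + _)%E](_ : _ = 0%E); last first.
    by apply: etrans (density_integralE m0) _; apply: integral0_eq => x /= ->.
  by rewrite add0e [leLHS](_ : _ = 0%E)//; exact: density_set1.
- move=> w /= h [[Xw fw] Xw0]; apply: h; split => //.
  by rewrite lt_neqAle X_ge0 andbT eq_sym; exact/eqP.
Qed.
End density.

(** * Second moment of the Laplace law *)

Section laplace.
Context {R : realType}.
Local Notation mu := (@lebesgue_measure R).
Implicit Types a b z : R.

Lemma cvg_poly2_expRN a b : 0 < b ->
  (z ^+ 2 + 2 * b * z + a) * expR (- (z / b)) @[z --> +oo] --> (0 : R).
Proof.
move=> b0.
have b3 : 0 < 6 * b ^+ 3 by rewrite mulr_gt0// exprn_gt0.
(* For [z >= 1] the quadratic is at most [c z^2], while [expR (z / b) >= (z / b)^3 / 6]. *)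
pose c := (1 + 2 * b + `|a|) * (6 * b ^+ 3).
apply/cvgrPdist_le => e e0; near=> z.
have z1 : 1 <= z by near: z; exact: nbhs_pinfty_ge.
have z0 : 0 < z by exact: lt_le_trans z1.
rewrite sub0r normrN normrM (ger0_norm (expR_ge0 _)) expRN.
have ez : (z ^+ 3) / (6 * b ^+ 3) <= expR (z / b).
  have zb : 0 <= z / b by rewrite divr_ge0 // ltW.
  apply: le_trans (expR_ge1Dxn 2 zb); rewrite expr_div_n [6 * _]mulrC invfM mulrA.
  by rewrite (_ : (3`!)%:R = 6)// lerDr.
have qz : `|z ^+ 2 + 2 * b * z + a| <= (1 + 2 * b + `|a|) * z ^+ 2.
  apply: le_trans (ler_normD _ _) _.
  rewrite (ger0_norm (_ : 0 <= z ^+ 2 + _)); last first.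
    by rewrite addr_ge0 ?sqr_ge0// !mulr_ge0// ltW.
  have : 2 * b * z <= 2 * b * z ^+ 2.
    rewrite ler_wpM2l ?(mulr_ge0, ltW b0)// expr2.
    by rewrite ler_peMl // ltW.
  have : `|a| * 1 <= `|a| * z ^+ 2 by rewrite ler_wpM2l// exprn_ege1.
  lra.
have z3 : 0 < z ^+ 3 / (6 * b ^+ 3) by rewrite divr_gt0// exprn_gt0.
apply: (@le_trans _ _ (c / z)).
  apply: (@le_trans _ _ ((1 + 2 * b + `|a|) * z ^+ 2 * (z ^+ 3 / (6 * b ^+ 3))^-1)).
    by apply: ler_pM => //; rewrite lef_pV2 ?posrE ?expR_gt0.
  rewrite le_eqVlt; apply/orP; left; apply/eqP; rewrite /c; field.
  by rewrite !gt_eqF.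
rewrite ler_pdivrMr// mulrC -ler_pdivrMr//.
Unshelve. all: by end_near. Qed.

(** Folding the line at 0 removes the absolute value and cancels the cross term [2 * a * z], leaving
    the integrand [k]; two integrations by parts give its antiderivative [F], which vanishes at
    infinity. *)
Lemma integral_laplace_sqr a b : 0 < b ->
  (\int[mu]_z ((a + z) ^+ 2 * laplace_pdf b z)%:E = (a ^+ 2 + 2 * b ^+ 2)%:E)%E.
Proof.
move=> b0.
have lap0 z : 0 <= laplace_pdf b z.
  by rewrite /laplace_pdf mulr_ge0 ?expR_ge0// invr_ge0 mulr_ge0// ltW.
have clap : continuous (laplace_pdf b).
  move=> z; apply: cvgM; first exact: cvg_cst.
  apply: continuous_comp; last exact: continuous_expR.
  apply: cvgN; apply: cvgM; last exact: cvg_cst.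
  exact: norm_continuous.
pose h z := (a + z) ^+ 2 * laplace_pdf b z.
have h0 z : 0 <= h z by rewrite mulr_ge0 ?sqr_ge0.
have ch : continuous h.
  move=> z; apply: cvgM; last exact: clap.
  have c1 : {for z, continuous (fun z => a + z)} by apply: cvgD; [exact: cvg_cst|exact: cvg_id].
  exact: (continuous_comp c1 (@exprn_continuous _ 2 _)).
have mh : measurable_fun setT (EFin \o h).
  by apply/measurable_EFinP; exact: continuous_measurable_fun.
rewrite -[LHS]/(\int[mu]_z (h z)%:E)%E.
have -> : setT = `]-oo, 0%R] `|` `]0%R, +oo[ :> set R.
  by rewrite itv_setU_setT.
rewrite ge0_integral_setU//=; last 3 first.
- exact: measurable_funTS.
- by move=> z _; rewrite lee_fin.
- apply/disj_set2P; apply/seteqP; split => // z /=; rewrite !in_itv/= andbT.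
  by case; rewrite leNgt => /negP.
rewrite -oppr0 ge0_integration_by_substitutionNy; last 2 first.
- exact: continuous_subspaceT.
- by move=> z _; exact: h0.
rewrite oppr0 integral_itv_obnd_cbnd; last exact: measurable_funTS.
rewrite -ge0_integralD//=; last 4 first.
- by move=> z _; rewrite lee_fin.
- apply/measurable_EFinP/measurable_funTS; apply: continuous_measurable_fun.
  by move=> z; apply: continuous_comp; [exact: opp_continuous|exact: ch].
- by move=> z _; rewrite lee_fin.
- exact: measurable_funTS.
pose F z : R := - ((z ^+ 2 + 2 * b * z + (2 * b ^+ 2 + a ^+ 2)) * expR (- (z / b))).
pose k z : R := (z ^+ 2 + a ^+ 2) / b * expR (- (z / b)).
transitivity (\int[mu]_(z in `[0%R, +oo[) (k z)%:E)%E.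
  apply: eq_integral => z; rewrite inE/= in_itv/= andbT => z0.
  rewrite -EFinD /h /k /laplace_pdf normrN ger0_norm//; congr EFin.
  by field; rewrite gt_eqF.
have dF z : is_derive z (1 : R) F (k z).
  have d1 : is_derive z (1 : R) (fun z : R => - (z / b)) (- b^-1).
    rewrite (_ : (fun _ => _) = (- b^-1) \*: (@id R)); last first.
      by apply/funext => x /=; rewrite mulrC -mulNr.
    by apply: is_derive_eq; rewrite -[LHS]/(_ * _) mulr1.
  have d2 : is_derive z (1 : R) (fun z : R => expR (- (z / b)))
      (expR (- (z / b)) * - b^-1).
    exact: (@is_derive1_comp _ expR).
  have d3 : is_derive z (1 : R)
      (fun z : R => z ^+ 2 + 2 * b * z + (2 * b ^+ 2 + a ^+ 2)) (2 * z + 2 * b).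
    rewrite (_ : (fun _ => _) = (@id R) ^+ 2 + (2 * b) \*: (@id R)
        + cst (2 * b ^+ 2 + a ^+ 2)) //.
    by apply: is_derive_eq; rewrite /GRing.scale/= !mulr1 addr0 expr1.
  have -> : F = - ((fun z : R => z ^+ 2 + 2 * b * z + (2 * b ^+ 2 + a ^+ 2)) *
     (fun z : R => expR (- (z / b)))) by [].
  apply: is_derive_eq; rewrite /k /GRing.scale/=; field.
  by rewrite gt_eqF.
have ck : continuous k.
  move=> z; apply: cvgM.
    apply: cvgM; last exact: cvg_cst.
    by apply: cvgD; [exact: exprn_continuous|exact: cvg_cst].
  apply: continuous_comp; last exact: continuous_expR.
  by apply: cvgN; apply: cvgM; [exact: cvg_id|exact: cvg_cst].
rewrite (@ge0_continuous_FTC2y _ k F 0 0).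
- rewrite -EFinB /F; congr EFin; rewrite mul0r oppr0 expR0; ring.
- move=> z z0; rewrite /k mulr_ge0 ?expR_ge0//.
  by rewrite divr_ge0 ?addr_ge0 ?sqr_ge0 ?(ltW b0).
- exact: continuous_subspaceT.
- rewrite -oppr0; apply: cvgN; exact: cvg_poly2_expRN.
- by move=> z _; exact: ex_derive.
- by apply/cvg_at_right_filter/differentiable_continuous/derivable1_diffP; exact: ex_derive.
- by move=> z _; rewrite derive1E derive_val.
Qed.
End laplace.

Section bounded_integrable.
Context {d : measure_display} {T : measurableType d} {R : realType}
  (P : probability T R).

Lemma bounded_integrable (u : T -> R) (k : R) :
  measurable_fun setT u -> (forall w, `|u w| <= k) ->
  P.-integrable setT (EFin \o u).
Proof.
move=> mu uk; apply: (le_integrable measurableT _ _ (g := EFin \o cst k)).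
- exact/measurable_EFinP.
- by move=> w _ /=; rewrite lee_fin (le_trans (uk w))// ler_norm.
- exact: finite_measure_integrable_cst.
Qed.

End bounded_integrable.

(** * Mean squared error of the linear estimator *)

Section mean_squared_error.
Context {d : measure_display} {T : measurableType d} {R : realType}
  (P : probability T R) {n : nat} (theta VAR : R) (Z : 'I_n -> {RV P >-> R}).
Hypotheses (Z_mean : forall i, ('E_P[Z i] = 0)%E)
  (Z_var : forall i, ('V_P[Z i] = VAR%:E)%E)
  (Z_bound : forall i w, `|Z i w| <= 2^-1)
  (Z_indep : mutually_independent P (fun i => Z i : T -> R)).

Let iZ i : P.-integrable setT (EFin \o Z i).
Proof. exact: bounded_integrable. Qed.

Let iZZ i j : P.-integrable setT (EFin \o (fun w => Z i w * Z j w)).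
Proof.
apply: (@bounded_integrable _ _ _ _ _ (2^-1 * 2^-1)); first exact: measurable_funM.
by move=> w; rewrite normrM ler_pM.
Qed.

Let EZ i : (\int[P]_w (Z i w)%:E = 0)%E.
Proof. by rewrite -expectation_def Z_mean. Qed.

Let integral_shift i : (\int[P]_w (Z i w + 2^-1)%:E = (2^-1)%:E)%E.
Proof.
under eq_integral do rewrite EFinD.
have ic := finite_measure_integrable_cst P (2^-1 : R).
rewrite (integralD measurableT (iZ i) (ic _ measurableT)).
by rewrite EZ add0e/= integral_cst//= probability_setT mule1.
Qed.

Let Z_shift i w : 0 <= Z i w + 2^-1.
Proof. by have := Z_bound i w; rewrite ler_norml => /andP[]; lra. Qed.

(** Resampling is available for nonnegative functions only, so for [i != j] the noises are shifted
    by [2^-1]. The product of the shifted noises has mean [2^-1 * 2^-1] by resampling, and the mean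
    of [Z i * Z j] plus [4^-1] by linearity. *)
Lemma noise_product_mean i j :
  (\int[P]_w (Z i w * Z j w)%:E = (if i == j then VAR else 0)%:E)%E.
Proof.
case: eqP => [<-|/eqP ij].
  rewrite -(Z_var i) /variance covarianceE.
  - by rewrite Z_mean mule0 sube0 unlock.
  - exact/Lfun1_integrable/iZ.
  - exact/Lfun1_integrable/iZ.
  - exact/Lfun1_integrable/iZZ.
(* The positive part gives nonnegativity on all tuples; on the values taken by the noises it is just
   the shift. *)
pose h (x : R) := Num.max (x + 2^-1) 0.
have mh : measurable_fun setT h.
  by apply: measurable_maxr => //; exact: measurable_funD.
have h0 x : 0 <= h x by rewrite /h le_max lexx orbT.
have hZ k w : h (Z k w) = Z k w + 2^-1 by rewrite /h max_l.
have := ge0_integral_resample Z_indep i (g := fun c => (h (tnth c i) * h (tnth c j))%:E).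
have -> : (\int[P]_w (h (tnth (sensitivities Z w) i) * h (tnth (sensitivities Z w) j))%:E
    = \int[P]_w (Z i w * Z j w)%:E + 4^-1%:E)%E.
  transitivity (\int[P]_w ((Z i w * Z j w)%:E + ((2^-1 * (Z i w + 2^-1))%:E + (2^-1 * Z j w)%:E)))%E.
    apply: eq_integral => w _; rewrite !tnth_mktuple !hZ -!EFinD; congr EFin.
    by field.
  have i0 : P.-integrable setT (fun w => (Z i w + 2^-1)%:E).
    apply: (@bounded_integrable _ _ _ _ _ 1); first exact: measurable_funD.
    by move=> w; have := Z_bound i w; rewrite !ler_norml => /andP[? ?]; apply/andP; split; lra.
  have i1 : P.-integrable setT (fun w => (2^-1 * (Z i w + 2^-1))%:E).
    by under eq_fun do rewrite EFinM; exact: integrableZl.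
  have i2 : P.-integrable setT (fun w => (2^-1 * Z j w)%:E).
    by under eq_fun do rewrite EFinM; apply: integrableZl => //; exact: iZ.
  rewrite integralD//; [|exact: iZZ|exact: integrableD].
  rewrite integralD//.
  under [X in (_ + (X + _))%E]eq_integral do rewrite EFinM.
  rewrite integralZl//.
  under [X in (_ + (_ + X))%E]eq_integral do rewrite EFinM.
  rewrite (integralZl measurableT (iZ j)) EZ mule0 adde0 integral_shift -EFinM.
  by congr (_ + _%:E)%E; field.
have -> : (\int[distribution P (Z i)]_x \int[P]_w
    (h (tnth (replace (sensitivities Z w) i x) i) *
     h (tnth (replace (sensitivities Z w) i x) j))%:E = 4^-1%:E)%E.
  transitivity (\int[distribution P (Z i)]_x ((h x)%:E * (2^-1)%:E))%E.
    apply: eq_integral => x _.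
    transitivity (\int[P]_w ((h x)%:E * (Z j w + 2^-1)%:E))%E.
      apply: eq_integral => w _; rewrite !tnth_replace eqxx eq_sym (negbTE ij).
      by rewrite tnth_mktuple hZ.
    rewrite ge0_integralZl//; last 3 first.
    - by apply/measurable_EFinP; exact: measurable_funD.
    - by move=> w _; rewrite lee_fin.
    - by rewrite lee_fin.
    by rewrite integral_shift.
  rewrite ge0_integralZr//; last 2 first.
  - exact/measurable_EFinP.
  - by move=> x _; rewrite lee_fin.
  rewrite ge0_integral_distribution//; last exact/measurable_EFinP.
  under eq_integral do rewrite /= hZ.
  by rewrite integral_shift -EFinM; congr EFin; field.
have fz : (\int[P]_w (Z i w * Z j w)%:E)%E \is a fin_num.
  by apply: integrable_fin_num => //; exact: iZZ.
move=> H; have {H} : (\int[P]_w (Z i w * Z j w)%:E + 4^-1%:E = 0 + 4^-1%:E)%E.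
  rewrite add0e.
  apply: H; last by move=> c; rewrite lee_fin mulr_ge0.
  by apply/measurable_EFinP; apply: measurable_funM;
    apply: (measurableT_comp mh); exact: measurable_tnth.
by move=> /(congr1 (fun x => x - 4^-1%:E)%E); rewrite !addeK.
Qed.

(** Weights of sum 1 cancel [theta]. The error is then a combination of uncorrelated noises plus
    Laplace noise of scale [(noise M c)^-1], whose variance is twice the square of its scale. *)
Lemma MSE_formula (M : mechanism R n) c :
  \sum_(i < n) tnth (weight M c) i = 1 -> 0 < noise M c ->
  MSE P theta Z M c =
  VAR * (\sum_(i < n) tnth (weight M c) i ^+ 2) + 2 / noise M c ^+ 2.
Proof.
set y := tnth (weight M c); set eta := noise M c => w1 eta0.
rewrite /MSE (_ : (\int[P]_w _)%E =
  (VAR * (\sum_(i < n) y i ^+ 2) + 2 / eta ^+ 2)%:E)//.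
transitivity (\int[P]_w
    (\sum_i \sum_j ((y i * y j) * (Z i w * Z j w))%:E + (2 / eta ^+ 2)%:E))%E.
  apply: eq_integral => w _.
  transitivity (((\sum_i y i * Z i w) ^+ 2 + 2 * (eta^-1) ^+ 2)%:E)%E.
    rewrite -(integral_laplace_sqr _ (_ : 0 < eta^-1)) ?invr_gt0//.
    apply: eq_integral => z _; congr (_ * _)%:E.
    rewrite real_normK ?num_real//; congr (_ ^+ 2).
    under eq_bigr do rewrite mulrDr.
    by rewrite big_split/= -mulr_suml w1 mul1r; ring.
  rewrite EFinD exprVn; congr (_ + _)%E.
  under [RHS]eq_bigr do rewrite sumEFin.
  rewrite sumEFin; congr EFin; rewrite expr2 mulr_suml; apply: eq_bigr => i _.
  by rewrite mulr_sumr; apply: eq_bigr => j _; ring.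
have iyy i j : P.-integrable setT (fun w => ((y i * y j) * (Z i w * Z j w))%:E).
  under eq_fun do rewrite EFinM.
  by apply: integrableZl => //; exact: iZZ.
rewrite integralD//; last 2 first.
- by apply: integrable_sum => // i _; apply: integrable_sum.
- exact: finite_measure_integrable_cst.
rewrite integral_cst//= probability_setT mule1 EFinD; congr (_ + _)%E.
rewrite integral_sum//; last by move=> i; exact: integrable_sum.
rewrite mulr_sumr -sumEFin; apply: eq_bigr => i _.
rewrite integral_sum// (bigD1 i)//= big1 ?adde0 => [|j ji].
  under eq_integral do rewrite EFinM.
  by rewrite integralZl ?noise_product_mean ?eqxx//; [rewrite -EFinM -expr2 mulrC|exact: iZZ].
under eq_integral do rewrite EFinM.
rewrite integralZl ?noise_product_mean ?(negbTE _)//; last exact: iZZ.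
by rewrite eq_sym (negbTE ji) mule0.
Qed.

End mean_squared_error.

(** * The program: lower bound by clipping, bounds and monotonicity of its solutions *)

Section program_theory.
Context {R : realType} {n : nat} (VAR : R).
Hypothesis VAR_ge0 : 0 <= VAR.
Implicit Types (p y z : n.-tuple R) (i : 'I_n).

(** In this form the first term is [n + 1] times the mean squared error with weights [y_i / S] and
    noise parameter [S], where [S] is the sum of the [y_j]. *)
Lemma program_costE p y : 0 < \sum_(j < n) tnth y j ->
  program_cost VAR p y =
  n.+1%:R * (VAR * (\sum_(i < n) (tnth y i / \sum_(j < n) tnth y j) ^+ 2)
             + 2 / (\sum_(j < n) tnth y j) ^+ 2)
  + \sum_(i < n) tnth p i * tnth y i.
Proof.
move=> S0; rewrite /program_cost; congr (_ + _).
under [in RHS]eq_bigr do rewrite expr_div_n.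
rewrite -mulr_suml -mulr_suml; field.
by rewrite gt_eqF.
Qed.

Lemma program_domW p y : program_dom y -> (forall i, 0 <= tnth p i) ->
  [/\ 0 < \sum_(j < n) tnth y j, forall i, 0 <= tnth y i &
      forall i, tnth p i * tnth y i <= \sum_(i < n) tnth p i * tnth y i].
Proof.
move=> [y0 S0] p0; split => // i.
by rewrite (bigD1 i)//= lerDl sumr_ge0// => j _; rewrite mulr_ge0.
Qed.

(* Clipping the negative weights to [0] can only lower the cost. *)
Lemma program_cost_clip p (w eps : 'I_n -> R) (eta : R) :
  (forall i, 0 <= tnth p i) -> (forall i, 0 <= eps i) ->
  \sum_(i < n) w i = 1 -> 0 < eta -> (forall i, eta * w i <= eps i) ->
  let q := n.+1%:R * (VAR * (\sum_(i < n) w i ^+ 2) + 2 / eta ^+ 2)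
    + \sum_(i < n) tnth p i * eps i in
  exists y, [/\ program_dom y, program_cost VAR p y <= q &
    q <= program_cost VAR p y -> (forall i, 0 < tnth p i) -> forall i,
      eps i = tnth y i /\ w i = tnth y i / \sum_(j < n) tnth y j].
Proof.
move=> p0 eps0 w1 eta0 weps q.
pose u i := Num.max (eta * w i) 0.
pose S := \sum_(i < n) u i.
have u0 i : 0 <= u i by rewrite le_max lexx orbT.
have wu i : eta * w i <= u i by rewrite le_max lexx.
have ueps i : u i <= eps i by rewrite ge_max weps eps0.
have u2 i : u i ^+ 2 <= eta ^+ 2 * w i ^+ 2.
  by rewrite -exprMn /u; have [_|_] := leP (eta * w i) 0; rewrite ?expr0n ?sqr_ge0.
(* As the weights sum to 1, [eta] is itself the sum of the [eta * w i]. *)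
have etaS : eta <= S.
  by rewrite -[leLHS]mulr1 -w1 mulr_sumr; exact: ler_sum.
have S0 : 0 < S by exact: lt_le_trans etaS.
pose y := [tuple u i | i < n].
have yE i : tnth y i = u i by rewrite tnth_mktuple.
have SE : \sum_(j < n) tnth y j = S by apply: eq_bigr => i _.
have ydom : program_dom y by split => [i|]; rewrite ?yE ?SE.
have costE : program_cost VAR p y =
    n.+1%:R * (VAR * (\sum_(i < n) (u i / S) ^+ 2) + 2 / S ^+ 2) + \sum_(i < n) tnth p i * u i.
  rewrite program_costE ?SE//; congr (_ * (_ * _ + _) + _);
  by apply: eq_bigr => i _; rewrite yE.
have le1 : 2 / S ^+ 2 <= 2 / eta ^+ 2.
  by rewrite ler_pM2l// lef_pV2 ?posrE ?exprn_gt0// lerXn2r ?nnegrE ?(ltW S0) ?(ltW eta0).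
have le2 : VAR * (\sum_(i < n) (u i / S) ^+ 2) <= VAR * (\sum_(i < n) w i ^+ 2).
  apply: ler_wpM2l => //; apply: ler_sum => i _.
  rewrite expr_div_n ler_pdivrMr ?exprn_gt0//.
  apply: le_trans (u2 i) _; rewrite mulrC ler_wpM2l ?sqr_ge0//.
  by rewrite lerXn2r ?nnegrE ?(ltW S0) ?(ltW eta0).
have le3 i : tnth p i * u i <= tnth p i * eps i by rewrite ler_wpM2l.
have le3s : \sum_(i < n) tnth p i * u i <= \sum_(i < n) tnth p i * eps i by exact: ler_sum.
have N0 : 0 < n.+1%:R :> R by rewrite ltr0Sn.
exists y; split => //.
  by rewrite costE /q lerD// ler_pM2l// lerD.
(* Each of the three parts of the cost is at most its counterpart in [q], so no part can be strictly
   smaller. The noise part gives [S = eta], the privacy part [eps = u]; finally [u i >= eta * w i]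
   with equal sums gives [u i = eta * w i]. *)
rewrite costE /q => le_q p_gt0.
have eq1 : 2 / S ^+ 2 = 2 / eta ^+ 2.
  apply/eqP; rewrite eq_le le1 -(ler_pM2l N0); move: le_q.
  have := ler_wpM2l (ltW N0) le2; have := ler_wpM2l (ltW N0) le1.
  by rewrite !mulrDr; lra.
have eq3 : \sum_(i < n) tnth p i * u i = \sum_(i < n) tnth p i * eps i.
  apply/eqP; rewrite eq_le le3s; move: le_q.
  have := ler_wpM2l (ltW N0) le2; have := ler_wpM2l (ltW N0) le1.
  by rewrite !mulrDr; lra.
have Seta : S = eta.
  move: eq1 => /(mulfI (_ : 2 != 0)) -/(_ _); rewrite pnatr_eq0 => /(_ isT).
  by move=> /invr_inj/eqP; rewrite eqrXn2 ?(ltW S0) ?(ltW eta0)// => /eqP.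
have epsE i : eps i = u i.
  have /eqP := eq3; rewrite eq_sym -subr_eq0 -sumrB psumr_eq0; last first.
    by move=> j _; rewrite subr_ge0.
  move=> /allP /(_ i (mem_index_enum _)); rewrite -mulrBr mulf_eq0 gt_eqF//=.
  by rewrite subr_eq0 => /eqP.
have wE i : u i = eta * w i.
  have : \sum_(i < n) (u i - eta * w i) = 0.
    by rewrite sumrB -mulr_sumr w1 mulr1 -/S Seta subrr.
  move=> /eqP; rewrite psumr_eq0; last by move=> j _; rewrite subr_ge0.
  move=> /allP /(_ i (mem_index_enum _)); rewrite subr_eq0 => /eqP //.
move=> i; rewrite SE yE epsE; split => //.
by rewrite Seta wE mulrAC divff ?mul1r// gt_eqF.
Qed.

(** Comparison with the [i]-th unit vector. The bound involves no price but the [i]-th, hence is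
    uniform in what the other users report. *)
Lemma solution_cost_le p y i : is_solution VAR p y ->
  program_cost VAR p y <= n.+1%:R * (2 + VAR) + tnth p i.
Proof.
move=> [_ ymin].
pose z := [tuple if j == i then 1 else 0 : R | j < n].
have zE j : tnth z j = if j == i then 1 else 0 by rewrite tnth_mktuple.
have S1 : \sum_(j < n) tnth z j = 1.
  by rewrite (bigD1 i)//= zE eqxx big1 ?addr0// => j /negbTE ji; rewrite zE ji.
apply: le_trans (ymin z _) _.
  by split; [move=> j; rewrite zE; case: ifP|rewrite S1].
rewrite /program_cost S1 expr1n divr1 (bigD1 i)//= zE eqxx expr1n mul1r big1; last first.
  by move=> j /negbTE ji; rewrite zE ji expr0n mul0r.
rewrite addr0 lerD2l (bigD1 i)//= zE eqxx mulr1 big1 ?addr0// => j /negbTE ji.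
by rewrite zE ji mulr0.
Qed.

(* Halving [y] must not improve the cost. *)
Lemma solution_cube_le p y i : is_solution VAR p y -> (forall i, 0 <= tnth p i) ->
  tnth p i * tnth y i ^+ 3 <= 12 * n.+1%:R.
Proof.
move=> [ydom ymin] p0; have [S0 y0 py] := program_domW ydom p0.
set S := \sum_(j < n) tnth y j in S0 *.
set N := n.+1%:R.
pose z := [tuple tnth y j / 2 | j < n].
have zE j : tnth z j = tnth y j / 2 by rewrite tnth_mktuple.
have SE : \sum_(j < n) tnth z j = S / 2.
  by rewrite /S mulr_suml; apply: eq_bigr => j _; rewrite zE.
have := ymin z; rewrite !program_costE ?SE//; last by rewrite divr_gt0.
have zdom : program_dom z by split => [j|]; [rewrite zE divr_ge0|rewrite SE divr_gt0].
move=> /(_ zdom).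
(* Halving preserves the weights, quadruples the noise term and halves the linear term [q].
   Optimality thus reads [q / 2 <= N * (8 - 2) / S ^+ 2], whence the constant 12. *)
have -> : \sum_(j < n) (tnth z j / (S / 2)) ^+ 2 = \sum_(j < n) (tnth y j / S) ^+ 2.
  by apply: eq_bigr => j _; rewrite zE; congr (_ ^+ 2); field; rewrite gt_eqF.
have -> : \sum_(j < n) tnth p j * tnth z j = (\sum_(j < n) tnth p j * tnth y j) / 2.
  by rewrite mulr_suml; apply: eq_bigr => j _; rewrite zE mulrA.
rewrite -/S -/N; have -> : 2 / (S / 2) ^+ 2 = 8 / S ^+ 2 by field; rewrite gt_eqF.
set V := VAR * _; set q := \sum_(j < n) _ * _ => h.
have {h} qS : q <= 12 * N / S ^+ 2.
  by move: h; rewrite !mulrDr; lra.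
have yS : tnth y i <= S by rewrite /S (bigD1 i)//= lerDl sumr_ge0.
rewrite exprSr mulrCA mulrA.
apply: (@le_trans _ _ (q * S ^+ 2)).
  rewrite -mulrA mulrC; apply: ler_pM; rewrite ?mulr_ge0 ?sqr_ge0//.
  by rewrite lerXn2r ?nnegrE// ltW.
by rewrite -ler_pdivlMr ?exprn_gt0.
Qed.

(** Adding the two optimality inequalities cancels everything except
    [(p'_i - p_i) * (y'_i - y_i) <= 0]. *)
Lemma solution_monotone p p' y y' i : is_solution VAR p y -> is_solution VAR p' y' ->
  (forall j, j != i -> tnth p j = tnth p' j) -> tnth p i < tnth p' i ->
  tnth y' i <= tnth y i.
Proof.
move=> [yd ymin] [y'd y'min] pp' lt_p.
pose A z := n.+1%:R / (\sum_(j < n) tnth z j) ^+ 2 *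
  (2 + \sum_(j < n) tnth z j ^+ 2 * VAR).
pose B z := \sum_(j < n | j != i) tnth p j * tnth z j.
have cE z : program_cost VAR p z = A z + (tnth p i * tnth z i + B z).
  by rewrite /program_cost [X in _ + X = _](bigD1 i).
have cE' z : program_cost VAR p' z = A z + (tnth p' i * tnth z i + B z).
  rewrite /program_cost [X in _ + X = _](bigD1 i)//=.
  by congr (_ + (_ + _)); apply: eq_bigr => j ji; rewrite pp'.
have := lerD (ymin _ y'd) (y'min _ yd); rewrite !cE !cE' => h.
rewrite -subr_ge0 -(pmulr_rge0 _ (_ : 0 < tnth p' i - tnth p i)) ?subr_gt0//.
by rewrite mulrBl !mulrBr; lra.
Qed.

End program_theory.

(** * Integral form of the envelope inequality *)

Section envelope.
Context {R : realType} (e h : R -> R) (a b : R).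
Local Notation mu := (@lebesgue_measure R).
Hypothesis e_ge0 : forall s, 0 <= e s.
Hypothesis e_meas : measurable_fun setT e.
(** For a truthful cost [h] with interim loss [e], the two bounds are incentive compatibility
    between [s] and [t] in the two directions. *)
Hypothesis h_lower : forall s t, a <= s -> s <= t -> t <= b ->
  (t - s) * e t <= h t - h s.
Hypothesis h_upper : forall s t, a <= s -> s <= t -> t <= b ->
  h t - h s <= (t - s) * e s.

Let e_decr s t : a <= s -> s <= t -> t <= b -> e t <= e s.
Proof.
move=> s0; rewrite le_eqVlt => /predU1P[->//|st] tb.
have := le_trans (h_lower s0 (ltW st) tb) (h_upper s0 (ltW st) tb).
by rewrite ler_pM2l// subr_gt0.
Qed.

Let step s t : a <= s -> s <= t -> t <= b ->
  (\int[mu]_(x in `[s, t]) (e x)%:E <= ((t - s) * e s)%:E)%E.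
Proof.
move=> s0 st tb.
apply: (@le_trans _ _ (\int[mu]_(x in `[s, t]) (cst (e s)%:E x))%E).
  apply: ge0_le_integral => //.
  - by move=> x _; rewrite lee_fin.
  - by apply/measurable_EFinP; exact: measurable_funTS.
  - move=> x /=; rewrite in_itv/= lee_fin => /andP[sx xt].
    by apply: e_decr => //; exact: le_trans tb.
rewrite integral_cst//= lebesgue_measure_itv/= lte_fin.
case: ltP => [_|ts]; first by rewrite -EFinB -EFinM mulrC.
by rewrite mule0 lee_fin mulr_ge0// subr_ge0.
Qed.

(** The left-endpoint sum bounds the integral because [e] is nonincreasing. Moving to right
    endpoints, where [h_lower] applies, costs [delta] times the drop of [e] on each piece. The start
    [s] is arbitrary because the induction peels off the leftmost piece. *)
Let riemann N : forall s delta : R, 0 <= delta -> a <= s -> s + delta *+ N <= b ->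
  (\int[mu]_(x in `[s, (s + delta *+ N)%R]) (e x)%:E <=
   (h (s + delta *+ N) - h s + delta * (e s - e (s + delta *+ N)))%:E)%E.
Proof.
elim: N => [|N IH] s delta d0 s0 sb.
  by rewrite mulr0n addr0 !subrr mulr0 addr0 set_itv1 integral_set1.
have sd : s <= s + delta by rewrite lerDl.
have dN : 0 <= delta *+ N by rewrite mulrn_wge0.
have sE : s + delta *+ N.+1 = s + delta + delta *+ N by rewrite mulrS addrA.
rewrite sE in sb *.
have sdb : s + delta <= b by apply: le_trans sb; rewrite lerDl.
have me A : measurable_fun A (EFin \o e).
  by apply/measurable_EFinP; exact: measurable_funTS.
rewrite (@itv_bndbnd_setU _ _ _ (BRight (s + delta))); last 2 first.
- by rewrite bnd_simp.
- by rewrite bnd_simp lerDl.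
rewrite ge0_integral_setU//=; last 3 first.
- exact: me.
- by move=> x _; rewrite lee_fin.
- apply/disj_set2P; apply/seteqP; split => // x /=; rewrite !in_itv/=.
  by move=> [/andP[_ xs] /andP[]]; rewrite ltNge xs.
rewrite integral_itv_obnd_cbnd; last exact: me.
apply: le_trans (leeD (step s0 sd sdb) (IH _ _ d0 (le_trans s0 sd) sb)) _.
rewrite -EFinD lee_fin.
have := h_lower s0 sd sdb.
by rewrite addrAC subrr add0r; lra.
Qed.

(* The error of the Riemann sums of [e] on [N] pieces telescopes to
   [(b - a) / N * (e a - e b)]. *)
Lemma envelope_integral_le : a <= b ->
  (\int[mu]_(x in `[a, b]) (e x)%:E <= (h b - h a)%:E)%E.
Proof.
move=> ab; apply/lee_addgt0Pr => r r0; rewrite -EFinD.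
pose k := (b - a) * (e a - e b).
(* Enough pieces for the error [k / N] to fall below [r]. *)
pose N := (Num.truncn (k / r)).+1.
have N0 : 0 < N%:R :> R by rewrite ltr0Sn.
pose delta := (b - a) / N%:R.
have dE : delta *+ N = b - a by rewrite -mulr_natr /delta divfK// gt_eqF.
have bE : a + delta *+ N = b by rewrite dE addrC subrK.
have d0 : 0 <= delta by rewrite divr_ge0// subr_ge0.
have := @riemann N a delta d0 (lexx _); rewrite bE => /(_ (lexx _)) /le_trans; apply.
rewrite lee_fin lerD2l /delta mulrAC ler_pdivrMr// -ler_pdivrMl// mulrC.
by apply/ltW; exact: truncnS_gt.
Qed.

End envelope.

(** * From compact subintervals to the whole tail of the support *)

Section interval_exhaustion.
Context {R : realType}.
Local Notation mu := (@lebesgue_measure R).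
Implicit Types (S : set R) (g : R -> \bar R) (a : R).

Lemma interval_leftE S a : is_interval S -> S a -> S `<=` `[a, +oo[ ->
  exists r, S = [set` Interval (BLeft a) r].
Proof.
move=> /is_intervalP SE Sa aS; move: SE Sa; case: (Rhull S) => l r SE Sa.
exists r; rewrite SE in Sa *; apply/seteqP; split => x /=.
  move=> xlr; have := aS x; rewrite {1}SE => /(_ xlr)/=; rewrite in_itv/= andbT.
  by move: xlr; rewrite !itv_boundlr bnd_simp => /andP[_ ->] ->.
move: Sa => /=; rewrite !itv_boundlr => /andP[la _] /andP[ax xr].
by rewrite xr andbT (le_trans la).
Qed.

(** The support may be unbounded or open on the right. Closed intervals starting at [a] exhaust it,
    and monotone convergence carries the bound to the limit. *)
Lemma integral_interval_le S a g (v : \bar R) :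
  is_interval S -> S a -> S `<=` `[a, +oo[ ->
  measurable_fun setT g -> (forall x, 0 <= g x)%E ->
  (forall b, S b -> (\int[mu]_(x in `[a, b]) g x <= v)%E) ->
  (\int[mu]_(x in S) g x <= v)%E.
Proof.
move=> Sitv Sa aS mg g0 H; have [r SE] := interval_leftE Sitv Sa aS.
have v0 : (0 <= v)%E by apply: le_trans (H a Sa); exact: integral_ge0.
have inS (F : (set R)^nat) : S = \bigcup_n F n -> nondecreasing_seq F ->
    (forall n, exists b, F n = `[a, b]%classic) -> (\int[mu]_(x in S) g x <= v)%E.
  move=> SF ndF itvF.
  have mF n : measurable (F n) by have [b ->] := itvF n.
  have cvF : (\int[mu]_(x in F n) g x @[n --> \oo] --> \int[mu]_(x in \bigcup_n F n) g x)%E.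
    by apply: ge0_nondecreasing_set_cvg_integral => // n; exact: measurable_funTS.
  rewrite SF -(cvg_lim _ cvF)//; apply: lime_le; first exact: cvgP cvF.
  apply: nearW => n; have [b Fb] := itvF n; rewrite Fb.
  (* The first intervals that approach an open right end may lie to the left of [a], in which case
     they are empty. *)
  have [ab|ba] := leP a b; last by rewrite set_itv_ge ?integral_set0// bnd_simp -ltNge.
  by apply: H; rewrite SF; exists n => //; rewrite Fb/= in_itv/= ab lexx.
case: r SE => [[] s|[]] SE.
- rewrite itv_bnd_open_bigcup in SE; apply: (inS _ SE) => [m k mk|k]; last by eexists.
  apply/subsetPset; apply: subset_itvl; rewrite bnd_simp lerD2l lerN2.
  by rewrite lef_pV2 ?posrE ?ltr0Sn// ler_nat.
- by rewrite SE; apply: H; move: Sa; rewrite SE /= !in_itv/= !lexx ?andbT.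
- by move: Sa; rewrite SE /= in_itv/= andbF.
- rewrite itv_bndy_bigcup_BRight in SE; apply: (inS _ SE) => [m k mk|k]; last by eexists.
  by apply/subsetPset; apply: subset_itvl; rewrite bnd_simp lerD2l ler_nat.
Qed.

End interval_exhaustion.

(** * Interim expectations and expected rents *)

Section screening.
Context {d : measure_display} {T : measurableType d} {R : realType}
  (P : probability T R) {n : nat} (C : 'I_n -> {RV P >-> R}) (f : 'I_n -> R -> R).
Hypotheses (C_ge0 : forall i w, 0 <= C i w)
  (C_density : forall i, has_density P (C i) (f i))
  (C_indep : mutually_independent P (fun i => C i : T -> R)).
Implicit Types (i : 'I_n) (x s : R) (g : n.-tuple R -> R).
Local Notation sens := (sensitivities C).

Definition interim i g x : \bar R := (\int[P]_w (g (replace (sens w) i x))%:E)%E.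

Lemma measurable_replace_sens i x :
  measurable_fun setT (fun w => replace (sens w) i x).
Proof. by apply: measurable_fun_replace => //; exact: measurable_sensitivities. Qed.

Lemma measurable_interim i g : measurable_fun setT g -> (forall c, 0 <= g c) ->
  measurable_fun setT (interim i g).
Proof.
move=> mg g0; apply: (@measurable_resample _ _ _ _ _ _ i (fun c => (g c)%:E)).
  exact/measurable_EFinP.
by move=> c; rewrite lee_fin.
Qed.

Lemma interim_ge0 i g x : (forall c, 0 <= g c) -> (0 <= interim i g x)%E.
Proof. by move=> g0; apply: integral_ge0 => w _; rewrite lee_fin. Qed.

Lemma integral_interim i g : measurable_fun setT g -> (forall c, 0 <= g c) ->
  (\int[P]_w interim i g (C i w) = \int[P]_w (g (sens w))%:E)%E.
Proof.
move=> mg g0; rewrite (@ge0_integral_resample _ _ _ _ _ _ C_indep i (fun c => (g c)%:E)).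
- rewrite ge0_integral_distribution//; last by move=> x; exact: interim_ge0.
  exact: measurable_interim.
- exact/measurable_EFinP.
- by move=> c; rewrite lee_fin.
Qed.

(** The inverse reversed hazard rate [F_i / f_i], equal to 0 where the density vanishes by the
    convention on division. *)
Definition hazard i x : R := fine (cdf (P := P) (C i) x) / f i x.

Lemma hazard_ge0 i x : 0 <= hazard i x.
Proof.
rewrite /hazard divr_ge0 ?fine_ge0 ?cdf_ge0//.
by have [_ f0 _] := C_density i; exact: f0.
Qed.

Lemma measurable_hazard i : measurable_fun setT (hazard i).
Proof.
have [mf _ _] := C_density i.
apply: measurable_funM; last exact: measurable_funV.
by apply: measurableT_comp => //; exact: cdf_measurable.
Qed.

Lemma hazard_indic i x : 0 <= x -> \1_(support_of (f i)) x * hazard i x = hazard i x.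
Proof.
move=> x0; rewrite indicE; have [|] := boolP (x \in _); first by rewrite mul1r.
rewrite notin_setE /support_of/= => /not_andP[//|/negP]; rewrite negbK => /eqP fx.
by rewrite /hazard fx invr0 mulr0 mul0r.
Qed.

Lemma virtual_costE i x : virtual_cost P (C i) (f i) x = x + hazard i x.
Proof. by []. Qed.

Lemma measurable_tnth_sens i : measurable_fun setT (fun w => tnth (sens w) i).
Proof. by apply: (measurableT_comp (measurable_tnth i)); exact: measurable_sensitivities. Qed.

Lemma tnth_sens w i : tnth (sens w) i = C i w.
Proof. by rewrite tnth_mktuple. Qed.

(** After [integral_rent], the hazard factor depends on the own report only. It can therefore enter
    the interim expectation, and undoing the resampling yields an expectation over the true
    profile. *)
Lemma integral_interim_rent i g : measurable_fun setT g -> (forall c, 0 <= g c) ->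
  (\int[P]_w rent (f i) (interim i g) (C i w) =
   \int[P]_w (hazard i (C i w) * g (sens w))%:E)%E.
Proof.
move=> mg g0.
have mI := measurable_interim i mg g0.
have I0 x := interim_ge0 i x g0.
pose k c := \1_(support_of (f i)) (tnth c i) * hazard i (tnth c i) * g c.
have mk : measurable_fun setT k.
  apply: measurable_funM => //; apply: measurable_funM.
    apply: (measurableT_comp _ (measurable_tnth i)); apply: measurable_indic.
    exact: measurable_support_of (C_density i).
  exact: (measurableT_comp (measurable_hazard i) (measurable_tnth i)).
have k0 c : 0 <= k c by rewrite mulr_ge0// mulr_ge0// hazard_ge0.
transitivity (\int[P]_w (k (sens w))%:E)%E; last first.
  by apply: eq_integral => w _; rewrite /k tnth_sens hazard_indic.
rewrite -(integral_interim i)//.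
transitivity (\int[distribution P (C i)]_x rent (f i) (interim i g) x)%E.
  rewrite ge0_integral_distribution//.
    exact: measurable_rent (C_density i) _ mI I0.
  by move=> x; exact: integral_ge0.
rewrite (integral_rent (C_density i))// ge0_integral_distribution//; last 2 first.
- apply: emeasurable_funM => //; apply/measurable_EFinP/measurable_funM.
    by apply: measurable_indic; exact: measurable_support_of (C_density i).
  exact: measurable_hazard.
- by move=> x; rewrite mule_ge0// lee_fin mulr_ge0// hazard_ge0.
apply: eq_integral => w _ /=; rewrite /interim -ge0_integralZl//; last 3 first.
- apply/measurable_EFinP.
  exact: measurableT_comp mg (measurable_replace_sens i _).
- by move=> v _; rewrite lee_fin.
- by rewrite lee_fin mulr_ge0// hazard_ge0.
by apply: eq_integral => v _; rewrite /k tnth_replace eqxx.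
Qed.

Lemma density_supports : {ae P, forall w, forall i,
  0 < C i w /\ support_of (f i) (C i w)}.
Proof.
by apply: filter_forall => i; exact: (density_support (C_density i) (C_ge0 i)).
Qed.

End screening.

(** * Lower bound on the expected payment to one user *)

Section user_bound.
Context {d : measure_display} {T : measurableType d} {R : realType}
  (P : probability T R) {n : nat} (C : 'I_n -> {RV P >-> R}) (f : 'I_n -> R -> R).
Hypotheses (C_ge0 : forall i w, 0 <= C i w)
  (C_density : forall i, has_density P (C i) (f i))
  (C_indep : mutually_independent P (fun i => C i : T -> R))
  (supp_itv : forall i, is_interval (support_of (f i))).
Local Notation sens := (sensitivities C).
Variables (i : 'I_n) (m e t : n.-tuple R -> R) (VAR : R).
Hypotheses (VAR_ge0 : 0 <= VAR) (m_meas : measurable_fun setT m) (m_ge0 : forall c, 0 <= m c)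
  (e_meas : measurable_fun setT e) (e_ge0 : forall c, 0 <= e c)
  (t_meas : measurable_fun setT t)
  (t_int : P.-integrable setT (fun w => (t (sens w))%:E))
  (t_int_replace : forall x, 0 <= x ->
    P.-integrable setT (fun w => (t (replace (sens w) i x))%:E)).

(** Abstract form of [COST], to be applied to functions extended by 0 off the orthant, so that signs
    and measurability hold on all tuples. *)
Definition interim_cost (x' x : R) : \bar R :=
  interim C i (fun c => m c + x * e c - t c) x'.

Lemma interim_costE x' x : 0 <= x' -> 0 <= x -> interim_cost x' x =
  (interim C i m x' + x%:E * interim C i e x' - interim C i t x')%E.
Proof.
move=> x'0 x0; rewrite /interim_cost /interim.
have mr := measurable_replace_sens C i x'.
have mm : measurable_fun setT (fun w => m (replace (sens w) i x')).
  exact: measurableT_comp m_meas mr.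
have me : measurable_fun setT (fun w => e (replace (sens w) i x')).
  exact: measurableT_comp e_meas mr.
rewrite (@ge0_integralB_EFin _ _ _ P
    (fun w => m (replace (sens w) i x') + x * e (replace (sens w) i x'))
    (fun w => t (replace (sens w) i x'))); last 3 first.
- by apply: measurable_funD => //; exact: measurable_funM.
- by move=> w; rewrite addr_ge0// mulr_ge0.
- exact: t_int_replace.
congr (_ - _)%E; rewrite -ge0_integralZl//; last 2 first.
- exact/measurable_EFinP.
- by move=> w _; rewrite lee_fin.
rewrite -ge0_integralD//.
- by move=> w _; rewrite lee_fin.
- exact/measurable_EFinP.
- by move=> w _; rewrite mule_ge0// lee_fin.
- by apply: emeasurable_funM => //; exact/measurable_EFinP.
Qed.

Hypotheses
  (IC : forall x x', support_of (f i) x -> support_of (f i) x' ->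
    (interim_cost x x <= interim_cost x' x)%E)
  (IR : forall x, support_of (f i) x -> (interim_cost x x <= VAR%:E)%E).

Let A := interim C i m.
Let E := interim C i e.
Let tau := interim C i t.

Let tau_fin x : 0 <= x -> tau x \is a fin_num.
Proof. by move=> x0; apply: integrable_fin_num => //; exact: t_int_replace. Qed.

(** Individual rationality bounds [A x + x * E x] by a finite payment plus [VAR]. At [x = 0] this
    would say nothing about [E], since 0 times [+oo] is 0. *)
Let AE_fin x : support_of (f i) x -> 0 < x -> A x \is a fin_num /\ E x \is a fin_num.
Proof.
move=> sx x0; have := IR sx; rewrite interim_costE ?(ltW x0)// -/(A x) -/(E x) -/(tau x).
have A0 : (0 <= A x)%E by exact: interim_ge0.
have E0 : (0 <= E x)%E by exact: interim_ge0.
have tf := tau_fin (ltW x0).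
rewrite leeBlDr// => AE.
have AEoo : (A x + x%:E * E x < +oo)%E.
  by apply: le_lt_trans AE _; rewrite -(fineK tf) -EFinD ltry.
have xE0 : (0 <= x%:E * E x)%E by rewrite mule_ge0// lee_fin ltW.
split; first by rewrite ge0_fin_numE// (le_lt_trans _ AEoo)// leeDl.
rewrite ge0_fin_numE// ltey; apply: contraTneq AEoo => ->.
by rewrite gt0_muley ?lte_fin// addey -?leNgt// gt_eqF// (lt_le_trans _ A0)// ltNye.
Qed.

(** Individual rationality is applied at every [b] in the support above [x], giving the same bound
    [VAR - h x] on each [[x, b]]; this covers supports without a largest point. All sensitivities
    involved are at least [x > 0], so [h] is an honest real function there. *)
Lemma user_envelope x : support_of (f i) x -> 0 < x ->
  (interim C i (fun c => m c + x * e c)%R x + rent (f i) E x <= tau x + VAR%:E)%E.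
Proof.
move=> sx x0.
pose S := support_of (f i) `&` `[x, +oo[.
pose h s := fine (A s) + s * fine (E s) - fine (tau s).
have Sgt0 s : S s -> 0 < s.
  by move=> [_]; rewrite /= in_itv/= andbT; exact: lt_le_trans.
have costE s' s : S s' -> S s -> interim_cost s' s =
    (fine (A s') + s * fine (E s') - fine (tau s'))%:E.
  move=> Ss' Ss; rewrite interim_costE ?(ltW (Sgt0 _ _))// -/(A s') -/(E s') -/(tau s').
  have [fA fE] := AE_fin Ss'.1 (Sgt0 _ Ss').
  by rewrite EFinB EFinD EFinM !fineK// tau_fin// ltW// Sgt0.
have Sx : S x by split => //=; rewrite in_itv/= lexx.
have Sitv : is_interval S.
  move=> a b [sa /= xa] [sb /= _] c acb; split; first exact: (supp_itv sa sb).
  by move: xa acb; rewrite /= !in_itv/= !andbT => xa /andP[ac _]; exact: le_trans ac.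
have mE : measurable_fun setT E by exact: measurable_interim.
have E0 s : (0 <= E s)%E by exact: interim_ge0.
have rent_le : (rent (f i) E x <= (VAR - h x)%:E)%E.
  apply: (integral_interval_le Sitv Sx) => //; first by move=> s [].
  move=> b Sb.
  have inS s : x <= s -> s <= b -> S s.
    by move=> xs sb; apply: (Sitv _ _ Sx Sb); rewrite xs.
  have xb : x <= b by case: Sb => _; rewrite /= in_itv/= andbT.
  have -> : (\int[lebesgue_measure]_(s in `[x, b]) E s =
      \int[lebesgue_measure]_(s in `[x, b]) (fine (E s))%:E)%E.
    apply: eq_integral => s; rewrite inE/= in_itv/= => /andP[xs sb].
    by rewrite fineK//; have := inS _ xs sb => Ss; have [] := AE_fin Ss.1 (Sgt0 _ Ss).
  apply: (@le_trans _ _ (h b - h x)%:E); last first.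
    rewrite lee_fin lerD2r -lee_fin /h -costE//; exact: IR Sb.1.
  apply: envelope_integral_le => //.
  - by move=> s; rewrite fine_ge0.
  - exact: measurableT_comp mE.
  - move=> s s' xs ss' s'b; have Ss' := inS _ (le_trans xs ss') s'b.
    have Ss := inS _ xs (le_trans ss' s'b).
    have := IC Ss.1 Ss'.1; rewrite !costE// lee_fin /h; lra.
  - move=> s s' xs ss' s'b; have Ss' := inS _ (le_trans xs ss') s'b.
    have Ss := inS _ xs (le_trans ss' s'b).
    have := IC Ss'.1 Ss.1; rewrite !costE// lee_fin /h; lra.
have [fA fE] := AE_fin sx x0.
have ft := tau_fin (ltW x0).
have -> : interim C i (fun c => m c + x * e c)%R x = (A x + x%:E * E x)%E.
  rewrite /A /E /interim -ge0_integralZl//; last 3 first.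
  - apply/measurable_EFinP.
    exact: measurableT_comp e_meas (measurable_replace_sens C i x).
  - by move=> w _; rewrite lee_fin.
  - by rewrite lee_fin ltW.
  rewrite -ge0_integralD//.
  - by move=> w _; rewrite lee_fin.
  - apply/measurable_EFinP.
    exact: measurableT_comp m_meas (measurable_replace_sens C i x).
  - by move=> w _; rewrite mule_ge0// lee_fin// ltW.
  - apply: emeasurable_funM => //; apply/measurable_EFinP.
    exact: measurableT_comp e_meas (measurable_replace_sens C i x).
apply: le_trans (leeD (lexx _) rent_le) _.
rewrite -(fineK fA) -(fineK fE) -(fineK ft) -EFinM -!EFinD lee_fin /h.
lra.
Qed.

(* Integrating [user_envelope] against the law of [C i]; the payment is split
   into its positive and negative parts so that only Tonelli is needed. *)
Lemma payment_lower_bound :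
  (\int[P]_w (m (sens w) + virtual_cost P (C i) (f i) (C i w) * e (sens w))%:E
   <= \int[P]_w (t (sens w))%:E + VAR%:E)%E.
Proof.
pose tp c := Num.max (t c) 0; pose tm c := Num.max (- t c) 0.
have tE c : t c = tp c - tm c.
  rewrite /tp /tm; have [t0|t0] := leP (t c) 0.
    by rewrite max_l ?oppr_ge0// sub0r opprK.
  by rewrite max_r ?subr0// oppr_le0 ltW.
have tp0 c : 0 <= tp c by rewrite le_max lexx orbT.
have tm0 c : 0 <= tm c by rewrite le_max lexx orbT.
have mtp : measurable_fun setT tp by exact: measurable_maxr.
have mtm : measurable_fun setT tm.
  by apply: measurable_maxr => //; exact: measurableT_comp.
have ip (c : T -> n.-tuple R) : measurable_fun setT c ->
    P.-integrable setT (fun w => (t (c w))%:E) ->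
    P.-integrable setT (fun w => (tp (c w))%:E) /\
    P.-integrable setT (fun w => (tm (c w))%:E).
  move=> mc ic; split; apply: (le_integrable measurableT _ _ ic).
  - exact/measurable_EFinP/(measurableT_comp mtp).
  - move=> w _ /=; rewrite lee_fin ger0_norm// /tp ge_max ler_norm normr_ge0//.
  - exact/measurable_EFinP/(measurableT_comp mtm).
  - by move=> w _ /=; rewrite lee_fin ger0_norm// /tm ge_max -normrN ler_norm normr_ge0.
(* Clipping the own sensitivity at 0 makes [b] nonnegative on all tuples; on true profiles nothing
   changes. *)
pose b c := m c + Num.max (tnth c i) 0 * e c.
have mb : measurable_fun setT b.
  apply: measurable_funD => //; apply: measurable_funM => //.
  by apply: measurable_maxr => //; exact: measurable_tnth.
have b0 c : 0 <= b c by rewrite addr_ge0// mulr_ge0// le_max lexx orbT.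
have mI (g : n.-tuple R -> R) : measurable_fun setT g -> (forall c, 0 <= g c) ->
    measurable_fun setT (fun w => interim C i g (C i w)).
  by move=> mg g0; exact: measurableT_comp (measurable_interim C i mg g0) _.
have mrent : measurable_fun setT (fun w => rent (f i) E (C i w)).
  apply: measurableT_comp => //; apply: measurable_rent (C_density i) _ _ _.
    exact: measurable_interim.
  by move=> s; exact: interim_ge0.
have rent0 x : (0 <= rent (f i) E x)%E.
  by apply: integral_ge0 => s _; exact: interim_ge0.
have I0 (g : n.-tuple R -> R) x : (forall c, 0 <= g c) -> (0 <= interim C i g x)%E by exact: interim_ge0.
(* The negative part of the payment is carried to the left, so that every integrand is nonnegative
   and resampling can be undone term by term. *)
have key : (\int[P]_w (interim C i b (C i w) + rent (f i) E (C i w) + interim C i tm (C i w))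
    <= \int[P]_w (interim C i tp (C i w) + VAR%:E))%E.
  apply: ae_ge0_le_integral => //.
  - by move=> w _; exact: (adde_ge0 (adde_ge0 (I0 _ _ b0) (rent0 _)) (I0 _ _ tm0)).
  - by apply: emeasurable_funD; [apply: emeasurable_funD|] => //; exact: mI.
  - move=> w _; apply: (adde_ge0 (I0 _ _ tp0)); by rewrite lee_fin.
  - by apply: emeasurable_funD => //; exact: mI.
  have := density_support (C_density i) (C_ge0 i); apply: filterS => w [x0 sx] _.
  set x := C i w in x0 sx *.
  have -> : interim C i b x = interim C i (fun c => m c + x * e c) x.
    apply: eq_integral => v _.
    by rewrite /b tnth_replace eqxx max_l// ltW.
  have [itp itm] := ip _ (measurable_replace_sens C i x) (t_int_replace (ltW x0)).
  have ftm : interim C i tm x \is a fin_num by exact: integrable_fin_num.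
  have tauE : tau x = (interim C i tp x - interim C i tm x)%E.
    rewrite /tau /interim -integralB_EFin//.
    by apply: eq_integral => v _; rewrite tE EFinB.
  have := user_envelope sx x0; rewrite tauE => /(leeD2r (interim C i tm x)) /le_trans; apply.
  by rewrite addeAC subeK.
have [itp itm] := ip _ (measurable_sensitivities C) t_int.
have ftm : (\int[P]_w (tm (sens w))%:E)%E \is a fin_num by exact: integrable_fin_num.
have ms := measurable_sensitivities C.
have haz0 x := hazard_ge0 C_density i x.
have mhe : measurable_fun setT (fun w => hazard C f i (C i w) * e (sens w)).
  apply: measurable_funM; last exact: measurableT_comp e_meas ms.
  by apply: measurableT_comp => //; exact: measurable_hazard.
have -> : (\int[P]_w (t (sens w))%:E =
    \int[P]_w (tp (sens w))%:E - \int[P]_w (tm (sens w))%:E)%E.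
  rewrite -integralB_EFin//.
  by apply: eq_integral => w _; rewrite tE EFinB.
have -> : (\int[P]_w (m (sens w) + virtual_cost P (C i) (f i) (C i w) * e (sens w))%:E =
   \int[P]_w (b (sens w))%:E + \int[P]_w (hazard C f i (C i w) * e (sens w))%:E)%E.
  rewrite -ge0_integralD//; last 4 first.
  - by move=> w _; rewrite lee_fin.
  - exact/measurable_EFinP/(measurableT_comp mb).
  - by move=> w _; rewrite lee_fin mulr_ge0.
  - exact/measurable_EFinP.
  apply: eq_integral => w _; rewrite -EFinD /b tnth_sens max_l//.
  by rewrite virtual_costE mulrDl addrA.
have Ib w : (0 <= interim C i b (C i w))%E := I0 _ _ b0.
have Ip w : (0 <= interim C i tp (C i w))%E := I0 _ _ tp0.
have Im w : (0 <= interim C i tm (C i w))%E := I0 _ _ tm0.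
move: key.
rewrite (@ge0_integralD _ _ _ P _ measurableT (fun w => interim C i b (C i w) + rent (f i) E (C i w))%E
    (fun w => interim C i tm (C i w))); last 4 first.
- by move=> w _; exact: (adde_ge0 (Ib w) (rent0 _)).
- by apply: emeasurable_funD => //; exact: mI.
- by [].
- exact: mI.
rewrite (@ge0_integralD _ _ _ P _ measurableT (fun w => interim C i b (C i w))
    (fun w => rent (f i) E (C i w))) //; last exact: mI.
rewrite (@ge0_integralD _ _ _ P _ measurableT (fun w => interim C i tp (C i w))
    (cst VAR%:E)) //; last exact: mI.
rewrite !integral_interim// integral_interim_rent// integral_cst//= probability_setT mule1.
rewrite -leeBrDr// => /le_trans; apply.
by rewrite addeAC.
Qed.

End user_bound.

(** * Lower bound on the cost of a feasible mechanism *)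

Section platform_lower_bound.
Context {d : measure_display} {T : measurableType d} {R : realType}
  (P : probability T R) {n : nat} (theta VAR : R)
  (Z C : 'I_n -> {RV P >-> R}) (f : 'I_n -> R -> R).
Hypotheses (n_gt0 : (0 < n)%N)
  (Z_mean : forall i, ('E_P[Z i] = 0)%E)
  (Z_var : forall i, ('V_P[Z i] = VAR%:E)%E)
  (Z_bound : forall i w, `|Z i w| <= 2^-1)
  (C_ge0 : forall i w, 0 <= C i w)
  (C_density : forall i, has_density P (C i) (f i))
  (ZC_indep : mutually_independent P
    (fun k : 'I_n + 'I_n => match k with inl i => Z i : T -> R | inr i => C i end))
  (supp_itv : forall i, is_interval (support_of (f i))).
Local Notation sens := (sensitivities C).
Implicit Types (M : mechanism R n) (c : n.-tuple R) (i : 'I_n).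

Lemma Z_indep : mutually_independent P (fun i => Z i : T -> R).
Proof.
move=> A mA; pose B (k : 'I_n + 'I_n) := if k is inl i then A i else setT.
have mB k : measurable (B k) by case: k => i /=.
have := ZC_indep mB; rewrite big_sumType/= [X in (_ * X)%E]big1 ?mule1 => [H|i _]; last first.
  by rewrite preimage_setT probability_setT.
rewrite -H; congr (P _); apply/seteqP; split => w /= h.
  by case=> i //; exact: h.
by move=> i; exact: (h (inl i)).
Qed.

Lemma C_indep : mutually_independent P (fun i => C i : T -> R).
Proof.
move=> A mA; pose B (k : 'I_n + 'I_n) := if k is inr i then A i else setT.
have mB k : measurable (B k) by case: k => i /=.
have := ZC_indep mB; rewrite big_sumType/= [X in (X * _)%E]big1 ?mul1e => [H|i _]; last first.
  by rewrite preimage_setT probability_setT.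
rewrite -H; congr (P _); apply/seteqP; split => w /= h.
  by case=> i //; exact: h.
by move=> i; exact: (h (inr i)).
Qed.

Lemma VAR_ge0 : 0 <= VAR.
Proof.
have : (0 <= 'V_P[Z (Ordinal n_gt0)])%E.
  exact: variance_ge0.
by rewrite Z_var lee_fin.
Qed.

Lemma measurable_orthant : measurable (orthant : set (n.-tuple R)).
Proof.
rewrite (_ : orthant = [set c | forall i, `[0, +oo[%classic (tnth c i)]).
  by apply: (measurable_box (A := fun=> `[0, +oo[%classic)) => i; exact: measurable_itv.
by apply/seteqP; split => c /= h i; have := h i; rewrite in_itv/= andbT.
Qed.

Lemma orthant_sens w : orthant (sens w).
Proof. by move=> i; rewrite tnth_sens. Qed.

Lemma orthant_replace c i x : orthant c -> 0 <= x -> orthant (replace c i x).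
Proof. by move=> c0 x0 j; rewrite tnth_replace; case: ifP. Qed.

(** A mechanism is constrained on the orthant alone; extension by 0 supplies the signs and
    measurability on all tuples that the one-user bound requires. *)
Let patch_orthant (g : n.-tuple R -> R) c : orthant c -> (g \_ orthant) c = g c.
Proof. by move=> c0; rewrite patchE mem_set. Qed.

Let patch_ge0 (g : n.-tuple R -> R) :
  (forall c, orthant c -> 0 <= g c) -> forall c, 0 <= (g \_ orthant) c.
Proof. by move=> g0; apply: restrict_ge0. Qed.

Let measurable_patch (g : n.-tuple R -> R) :
  measurable_fun orthant g -> measurable_fun setT (g \_ orthant).
Proof. by move=> mg; apply/(measurable_restrictT _ measurable_orthant). Qed.

Lemma MSE_mechanismE M c : is_mechanism C M -> orthant c ->
  MSE P theta Z M c =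
  VAR * (\sum_(i < n) tnth (weight M c) i ^+ 2) + 2 / noise M c ^+ 2.
Proof.
move=> [_ /(_ c) cM _ _] c0; have [_ w1 eta0 _] := cM c0.
exact: (MSE_formula _ Z_mean Z_var Z_bound Z_indep).
Qed.

Lemma MSE_mechanism_ge0 M c : is_mechanism C M -> orthant c -> 0 <= MSE P theta Z M c.
Proof.
move=> mM c0; rewrite MSE_mechanismE// addr_ge0 ?divr_ge0 ?sqr_ge0//.
by rewrite mulr_ge0 ?VAR_ge0// sumr_ge0// => i _; exact: sqr_ge0.
Qed.

Lemma measurable_MSE M : is_mechanism C M ->
  measurable_fun orthant (MSE P theta Z M).
Proof.
move=> mM; have [[_ _ mw meta] _ _ _] := mM.
apply: (eq_measurable_fun (fun c =>
  VAR * (\sum_(i < n) tnth (weight M c) i ^+ 2) + 2 / noise M c ^+ 2)).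
  by move=> c; rewrite inE => c0; rewrite MSE_mechanismE.
apply: measurable_funD.
  apply: measurable_funM => //; apply: measurable_sum => i.
  by apply: measurable_funX; exact: (measurableT_comp (measurable_tnth i)).
by apply: measurable_funM => //; apply: measurable_funV; exact: measurable_funX.
Qed.

Lemma user_lower_bound M i : feasible P theta VAR Z C f M ->
  (\int[P]_w (MSE P theta Z M (sens w)
     + virtual_cost P (C i) (f i) (C i w) * tnth (loss M (sens w)) i)%:E
   <= \int[P]_w (tnth (payment M (sens w)) i)%:E + VAR%:E)%E.
Proof.
move=> [mM IC IR]; have [[ml mp _ _] cM ip ipr] := mM.
pose m := (MSE P theta Z M) \_ orthant.
pose e := (fun c => tnth (loss M c) i) \_ orthant.
pose t := (fun c => tnth (payment M c) i) \_ orthant.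
have meE w : m (sens w) = MSE P theta Z M (sens w).
  by rewrite /m patch_orthant//; exact: orthant_sens.
have eE w : e (sens w) = tnth (loss M (sens w)) i.
  by rewrite /e patch_orthant//; exact: orthant_sens.
have tE w : t (sens w) = tnth (payment M (sens w)) i.
  by rewrite /t patch_orthant//; exact: orthant_sens.
have orep w x : 0 <= x -> orthant (replace (sens w) i x).
  by move=> x0; apply: orthant_replace => //; exact: orthant_sens.
have costE x' x : 0 <= x' -> interim_cost (P := P) C i m e t x' x = COST P theta Z C M i x' x.
  move=> x'0; rewrite /COST unlock; apply: eq_integral => w _.
  by rewrite /m /e /t !patch_orthant//; exact: orep.
under eq_integral do rewrite -meE -eE.
under [in leRHS]eq_integral do rewrite -tE.
apply: (payment_lower_bound C_ge0 C_density C_indep supp_itv) => //.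
- exact: VAR_ge0.
- by apply: measurable_patch; exact: measurable_MSE.
- by apply: patch_ge0 => c c0; exact: MSE_mechanism_ge0.
- by apply: measurable_patch; exact: (measurableT_comp (measurable_tnth i)).
- by apply: patch_ge0 => c c0; have [l0 _ _ _] := cM _ c0; exact: l0.
- by apply: measurable_patch; exact: (measurableT_comp (measurable_tnth i)).
- by under eq_fun do rewrite tE; exact: ip.
- move=> x x0; rewrite (_ : (fun w => _) =
      (fun w => (tnth (payment M (replace (sens w) i x)) i)%:E)); first exact: ipr.
  by apply/funext => w; rewrite /t patch_orthant//; exact: orep.
- move=> x x' sx sx'; rewrite !costE ?sx.1 ?sx'.1//.
  by apply: IC => //; exact: sx'.1.
- by move=> x sx; rewrite costE ?sx.1//; exact: IR.
Qed.

(** The integrand of the virtual objective: [n] of the copies of the mean squared error come from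
    the users' bounds, the last is the platform's. *)
Definition virtual_total M c : R :=
  n.+1%:R * MSE P theta Z M c
  + \sum_(i < n) tnth (virtual_costs P C f c) i * tnth (loss M c) i.

Lemma virtual_cost_ge0 i x : 0 <= x -> 0 <= virtual_cost P (C i) (f i) x.
Proof. by move=> x0; rewrite virtual_costE addr_ge0// (hazard_ge0 C_density). Qed.

Lemma tnth_virtual_costs c i :
  tnth (virtual_costs P C f c) i = virtual_cost P (C i) (f i) (tnth c i).
Proof. by rewrite tnth_mktuple. Qed.

Lemma measurable_virtual_cost i : measurable_fun setT (virtual_cost P (C i) (f i)).
Proof. by apply: measurable_funD => //; exact: measurable_hazard. Qed.

(** The first half adds the users' bounds. For the second, payments are integrable, so each of these
    bounds is finite, and the bound of a single user already makes the expected mean squared error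
    finite. *)
Lemma platform_lower_bound M : feasible P theta VAR Z C f M ->
  (\int[P]_w (virtual_total M (sens w))%:E <= platform_cost theta Z C M + (n%:R * VAR)%:E
   /\ \int[P]_w (virtual_total M (sens w))%:E < +oo)%E.
Proof.
move=> fM; have [mM _ _] := fM; have [[ml mp _ _] cM ip _] := mM.
have ms := measurable_sensitivities C.
have mcomp (g : n.-tuple R -> R) : measurable_fun orthant g ->
    measurable_fun setT (fun w => g (sens w)).
  move=> mg; rewrite (_ : (fun w => _) = (g \_ orthant) \o sens).
    by apply: measurableT_comp => //; exact: measurable_patch.
  by apply/funext => w /=; rewrite patch_orthant//; exact: orthant_sens.
have mM' := mcomp _ (measurable_MSE mM).
have ml' i := mcomp _ (measurableT_comp (measurable_tnth i) ml).
have M0 w : 0 <= MSE P theta Z M (sens w).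
  by apply: MSE_mechanism_ge0 => //; exact: orthant_sens.
have l0 i w : 0 <= tnth (loss M (sens w)) i.
  by have [l0 _ _ _] := cM _ (orthant_sens w); exact: l0.
have psi0 i w : 0 <= virtual_cost P (C i) (f i) (C i w) by exact: virtual_cost_ge0.
have mpsi i : measurable_fun setT (fun w => virtual_cost P (C i) (f i) (C i w)).
  by apply: measurableT_comp => //; exact: measurable_virtual_cost.
have Et i : (\int[P]_w (tnth (payment M (sens w)) i)%:E)%E \is a fin_num.
  by apply: integrable_fin_num => //; exact: ip.
have costE : platform_cost theta Z C M =
  (\int[P]_w (MSE P theta Z M (sens w))%:E + \sum_(i < n) \int[P]_w (tnth (payment M (sens w)) i)%:E)%E.
  rewrite /platform_cost unlock -integral_sum//.
  pose v w := - \sum_(i < n) tnth (payment M (sens w)) i.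
  have iv0 : P.-integrable setT (fun w => \sum_(i < n) (tnth (payment M (sens w)) i)%:E).
    by apply: integrable_sum.
  have iv : P.-integrable setT (EFin \o v).
    rewrite (_ : EFin \o v = \- (fun w => \sum_(i < n) (tnth (payment M (sens w)) i)%:E))%E.
      exact: integrableN.
    by apply/funext => w; rewrite /= sumEFin.
  transitivity (\int[P]_w (MSE P theta Z M (sens w) - v w)%:E)%E.
    by apply: eq_integral => w _; rewrite /v opprK.
  rewrite ge0_integralB_EFin//; congr (_ + _)%E.
  rewrite (_ : (\int[P]_w (v w)%:E)%E =
    (\int[P]_w (- \sum_(i < n) (tnth (payment M (sens w)) i)%:E))%E); last first.
    by apply: eq_integral => w _; rewrite sumEFin.
  by rewrite integralN ?oppeK//; exact: integrable_add_def.
have le_i i := user_lower_bound i fM.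
have mterm i : measurable_fun setT (fun w => MSE P theta Z M (sens w)
     + virtual_cost P (C i) (f i) (C i w) * tnth (loss M (sens w)) i).
  by apply: measurable_funD => //; apply: measurable_funM => //; exact: ml'.
have term0 i w : 0 <= MSE P theta Z M (sens w)
     + virtual_cost P (C i) (f i) (C i w) * tnth (loss M (sens w)) i.
  by rewrite addr_ge0// mulr_ge0.
have totE : (\int[P]_w (virtual_total M (sens w))%:E =
   \int[P]_w (MSE P theta Z M (sens w))%:E + \sum_(i < n)
     \int[P]_w (MSE P theta Z M (sens w)
     + virtual_cost P (C i) (f i) (C i w) * tnth (loss M (sens w)) i)%:E)%E.
  rewrite -ge0_integral_sum//; last 2 first.
  - by move=> i; exact/measurable_EFinP.
  - by move=> i w _; rewrite lee_fin.
  rewrite -ge0_integralD//; last 4 first.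
  - by move=> w _; rewrite lee_fin.
  - exact/measurable_EFinP.
  - by move=> w _; rewrite sume_ge0// => i _; rewrite lee_fin.
  - by apply: emeasurable_sum => i; exact/measurable_EFinP.
  apply: eq_integral => w _; rewrite sumEFin -EFinD; congr EFin.
  rewrite big_split/= sumr_const card_ord addrA /virtual_total; congr (_ + _).
    by rewrite -mulrS mulr_natl.
  by apply: eq_bigr => i _; rewrite tnth_virtual_costs tnth_sens.
have sum_le : (\sum_(i < n) \int[P]_w (MSE P theta Z M (sens w)
     + virtual_cost P (C i) (f i) (C i w) * tnth (loss M (sens w)) i)%:E
   <= \sum_(i < n) \int[P]_w (tnth (payment M (sens w)) i)%:E + (n%:R * VAR)%:E)%E.
  apply: (@le_trans _ _ (\sum_(i < n) (\int[P]_w (tnth (payment M (sens w)) i)%:E + VAR%:E)%E)).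
    by apply: lee_sum => i _; exact: le_i.
  by rewrite big_split/= sumEFin sumr_const card_ord mulr_natl.
split.
  by rewrite totE costE; apply: le_trans (leeD (lexx _) sum_le) _; rewrite addeA.
have EM_lty : (\int[P]_w (MSE P theta Z M (sens w))%:E < +oo)%E.
  apply: (@le_lt_trans _ _
      (\int[P]_w (tnth (payment M (sens w)) (Ordinal n_gt0))%:E + VAR%:E)%E).
    apply: le_trans (le_i (Ordinal n_gt0)).
    apply: (@ge0_le_integral _ _ _ P _ measurableT
        (fun w => (MSE P theta Z M (sens w))%:E) (fun w => (MSE P theta Z M (sens w)
     + virtual_cost P (C _) (f _) (C _ w) * tnth (loss M (sens w)) _)%:E)).
    - by move=> w _; rewrite lee_fin.
    - exact/measurable_EFinP.
    - exact/measurable_EFinP.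
    - by move=> w _; rewrite lee_fin lerDl mulr_ge0.
  by rewrite -(fineK (Et _)) -EFinD ltry.
rewrite totE; apply: lte_add_pinfty => //.
apply: le_lt_trans sum_le _.
have -> : (\sum_(i < n) \int[P]_w (tnth (payment M (sens w)) i)%:E =
    (\sum_(i < n) fine (\int[P]_w (tnth (payment M (sens w)) i)%:E))%:E)%E.
  by rewrite -sumEFin; apply: eq_bigr => i _; rewrite fineK.
by rewrite -EFinD ltry.
Qed.

End platform_lower_bound.

Lemma ae_exists {d : measure_display} {T : measurableType d} {R : realType}
    (P : probability T R) (Q : T -> Prop) :
  {ae P, forall w, Q w} -> exists w, Q w.
Proof.
move=> [A [mA A0 QA]]; apply: contrapT => nQ.
have AT : A = setT by apply/seteqP; split => // w _; apply: QA => /= Qw; apply: nQ; exists w.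
by move: A0; rewrite AT probability_setT => /eqP; rewrite onee_eq0.
Qed.

(** * Integrability of the inverse square root at 0 *)

Section inverse_sqrt.
Context {R : realType}.
Local Notation mu := (@lebesgue_measure R).

Lemma measurable_inv_sqrt : measurable_fun setT (fun s : R => (Num.sqrt s)^-1).
Proof.
by apply: measurable_funV; apply: continuous_measurable_fun; exact: sqrt_continuous.
Qed.

(** The envelope inequality for [h s = 2 * Num.sqrt s], followed by exhaustion from the left. This
    controls interim losses near sensitivity 0. *)
Lemma integral_inv_sqrt_le (b : R) : 0 < b ->
  (\int[mu]_(s in `]0%R, b]) ((Num.sqrt s)^-1)%:E <= (2 * Num.sqrt b)%:E)%E.
Proof.
move=> b0.
have e0 (s : R) : 0 <= (Num.sqrt s)^-1 by rewrite invr_ge0 sqrtr_ge0.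
have mono (a c : R) : 0 < a -> a <= c -> [/\ 0 < Num.sqrt a, Num.sqrt a <= Num.sqrt c
    & c - a = (Num.sqrt c - Num.sqrt a) * (Num.sqrt c + Num.sqrt a)].
  move=> a0 ac; rewrite sqrtr_gt0 ler_wsqrtr//; split => //.
  by rewrite -subr_sqr !sqr_sqrtr ?(ltW a0)// (le_trans (ltW a0)).
have le_ab (a : R) : 0 < a -> a <= b ->
    (\int[mu]_(s in `[a, b]) ((Num.sqrt s)^-1)%:E <= (2 * Num.sqrt b)%:E)%E.
  move=> a0 ab.
  apply: (@le_trans _ _ (2 * Num.sqrt b - 2 * Num.sqrt a)%:E); last first.
    by rewrite lee_fin lerBlDr lerDl mulr_ge0 ?sqrtr_ge0.
  apply: (@envelope_integral_le _ _ (fun s => 2 * Num.sqrt s)) => //.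
  - exact: measurable_inv_sqrt.
  - move=> s t as_ st tb; have [s0 le_st ->] := mono s t (lt_le_trans a0 as_) st.
    have t0 := lt_le_trans s0 le_st; rewrite ler_pdivrMr//.
    by have := sqr_ge0 (Num.sqrt t - Num.sqrt s); nra.
  - move=> s t as_ st tb; have [s0 le_st ->] := mono s t (lt_le_trans a0 as_) st.
    have t0 := lt_le_trans s0 le_st; rewrite ler_pdivlMr//.
    by have := sqr_ge0 (Num.sqrt t - Num.sqrt s); nra.
have m_ A : measurable_fun A (fun s : R => ((Num.sqrt s)^-1)%:E).
  by apply/measurable_EFinP; apply: measurable_funTS; exact: measurable_inv_sqrt.
pose F k := `[(0 + k.+1%:R^-1 : R), b]%classic.
have SF : `]0%R, b]%classic = \bigcup_k F k by rewrite itv_open_bnd_bigcup.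
have cvF : (\int[mu]_(s in F k) ((Num.sqrt s)^-1)%:E @[k --> \oo] -->
    \int[mu]_(s in \bigcup_k F k) ((Num.sqrt s)^-1)%:E)%E.
  apply: ge0_nondecreasing_set_cvg_integral => [m k mk|k|k|k x _] //;
    [|exact: measurable_itv|exact: m_].
  apply/subsetPset; apply: subset_itvr; rewrite bnd_simp lerD2l.
  by rewrite lef_pV2 ?posrE ?ltr0Sn// ler_nat.
apply: (@le_trans _ _ (\int[mu]_(s in \bigcup_k F k) ((Num.sqrt s)^-1)%:E)%E).
  by rewrite -SF.
rewrite -(cvg_lim _ cvF)//; apply: lime_le; first exact: cvgP cvF.
apply: nearW => k; rewrite /F add0r.
have [ab|ba] := leP k.+1%:R^-1 b; first by apply: le_ab => //; rewrite invr_gt0 ltr0Sn.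
rewrite set_itv_ge; last by rewrite bnd_simp -ltNge.
by rewrite integral_set0 lee_fin mulr_ge0 ?sqrtr_ge0.
Qed.

End inverse_sqrt.

(** * Construction, feasibility and cost of the optimal mechanism *)

Section optimal_mechanism.
Context {d : measure_display} {T : measurableType d} {R : realType}
  (P : probability T R) {n : nat} (theta VAR : R)
  (Z C : 'I_n -> {RV P >-> R}) (f : 'I_n -> R -> R)
  (ystar : n.-tuple R -> n.-tuple R).
Hypotheses (n_gt0 : (0 < n)%N)
  (Z_mean : forall i, ('E_P[Z i] = 0)%E)
  (Z_var : forall i, ('V_P[Z i] = VAR%:E)%E)
  (Z_bound : forall i w, `|Z i w| <= 2^-1)
  (C_ge0 : forall i w, 0 <= C i w)
  (C_density : forall i, has_density P (C i) (f i))
  (ZC_indep : mutually_independent P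
    (fun k : 'I_n + 'I_n => match k with inl i => Z i : T -> R | inr i => C i end))
  (supp_itv : forall i, is_interval (support_of (f i)))
  (virtual_cost_incr : forall i,
    {in support_of (f i) &, {homo virtual_cost P (C i) (f i) : x y / x <= y}})
  (ystar_meas : measurable_fun (supports f)
    (fun c => ystar (virtual_costs P C f c)))
  (ystar_sol : forall c, supports f c ->
    is_solution VAR (virtual_costs P C f c) (ystar (virtual_costs P C f c))).
Local Notation sens := (sensitivities C).
Implicit Types (M : mechanism R n) (c : n.-tuple R) (i : 'I_n) (x s : R).

Let VAR0 : 0 <= VAR. Proof. exact: VAR_ge0 n_gt0 Z_var. Qed.
Let psi i := virtual_cost P (C i) (f i).
Let y c i := tnth (ystar (virtual_costs P C f c)) i.
Let total c := \sum_(j < n) y c j.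
Let N : R := n.+1%:R.

Definition solution_mse c : R :=
  VAR * (\sum_(i < n) (y c i / total c) ^+ 2) + 2 / total c ^+ 2.

Definition solution_value c : R :=
  program_cost VAR (virtual_costs P C f c) (ystar (virtual_costs P C f c)).

Lemma measurable_supports : measurable (supports f).
Proof.
by apply: (measurable_box (A := fun i => support_of (f i))) => i;
  exact: measurable_support_of (C_density i).
Qed.

Lemma supports_orthant c : supports f c -> orthant c.
Proof. by move=> sc i; have [] := sc i. Qed.

Lemma supports_replace c i x : supports f c -> support_of (f i) x ->
  supports f (replace c i x).
Proof. by move=> sc sx j; rewrite tnth_replace; case: eqP => // ->. Qed.

Lemma sens_supports : {ae P, forall w, supports f (sens w)}.
Proof.
have := density_supports C_ge0 C_density; apply: filterS => w Cw i.
by rewrite tnth_sens; have [] := Cw i.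
Qed.

Lemma psi_ge i x : x <= psi i x.
Proof. by rewrite /psi virtual_costE lerDl (hazard_ge0 C_density). Qed.

Lemma solution_facts c : supports f c ->
  [/\ 0 < total c, forall i, 0 <= y c i, forall i, 0 <= tnth (virtual_costs P C f c) i &
      solution_value c = N * solution_mse c + \sum_(i < n) psi i (tnth c i) * y c i].
Proof.
move=> sc; have [ydom _] := ystar_sol sc.
have p0 i : 0 <= tnth (virtual_costs P C f c) i.
  by rewrite tnth_virtual_costs (virtual_cost_ge0 C_density)//; case: (sc i).
have [S0 y0 _] := program_domW ydom p0.
split => //; rewrite /solution_value program_costE//; congr (_ + _).
by apply: eq_bigr => i _; rewrite tnth_virtual_costs.
Qed.

Lemma solution_mse_ge0 c : 0 <= solution_mse c.
Proof.
rewrite /solution_mse addr_ge0 ?divr_ge0 ?sqr_ge0// mulr_ge0// sumr_ge0// => i _.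
exact: sqr_ge0.
Qed.

Lemma solution_value_ge0 c : supports f c -> 0 <= solution_value c.
Proof.
move=> sc; have [_ y0 p0 ->] := solution_facts sc.
rewrite addr_ge0 ?mulr_ge0 ?solution_mse_ge0 ?ler0n// sumr_ge0// => i _.
by rewrite mulr_ge0//; have := p0 i; rewrite tnth_virtual_costs.
Qed.

(** Three kinds of control. Bounds in the own sensitivity alone give integrability after a fixed
    report, bounds by the value of the program give it along true profiles, and the cubic bound
    tames small sensitivities. *)
Lemma solution_bounds c i : supports f c ->
  [/\ solution_mse c <= N * (2 + VAR) + psi i (tnth c i),
      tnth c i * y c i <= N * (2 + VAR) + psi i (tnth c i),
      hazard C f i (tnth c i) * y c i <= solution_value c,
      tnth c i * y c i <= solution_value c &
      tnth c i * y c i ^+ 3 <= 12 * N].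
Proof.
move=> sc; have [S0 y0 p0 vE] := solution_facts sc.
have sol := ystar_sol sc.
have ci0 : 0 <= tnth c i by case: (sc i).
have := solution_cost_le i sol.
rewrite -/(solution_value c) tnth_virtual_costs -/(psi i _) -/N => vle.
have cu := solution_cube_le i sol p0; rewrite tnth_virtual_costs in cu.
have psum : psi i (tnth c i) * y c i <= \sum_(j < n) psi j (tnth c j) * y c j.
  rewrite (bigD1 i)//= lerDl sumr_ge0// => j _.
  by rewrite mulr_ge0//; have := p0 j; rewrite tnth_virtual_costs.
have m0 := solution_mse_ge0 c.
have mN : solution_mse c <= N * solution_mse c by rewrite ler_peMl// ler1n.
have sum0 : 0 <= \sum_(j < n) psi j (tnth c j) * y c j.
  by rewrite sumr_ge0// => j _; rewrite mulr_ge0//; have := p0 j; rewrite tnth_virtual_costs.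
have cy : tnth c i * y c i <= psi i (tnth c i) * y c i by rewrite ler_wpM2r// psi_ge.
have hy : hazard C f i (tnth c i) * y c i <= psi i (tnth c i) * y c i.
  by rewrite ler_wpM2r// /psi virtual_costE lerDr.
have Nm0 : 0 <= N * solution_mse c by rewrite mulr_ge0 ?ler0n.
split; [lra|lra|lra|lra|].
by apply: le_trans cu; rewrite ler_wpM2r ?exprn_ge0// psi_ge.
Qed.

Lemma solution_antitone c i s s' : supports f c -> support_of (f i) s ->
  support_of (f i) s' -> s <= s' -> y (replace c i s') i <= y (replace c i s) i.
Proof.
move=> sc ss ss' le_s.
have pE j r : tnth (virtual_costs P C f (replace c i r)) j =
    if j == i then psi i r else psi j (tnth c j).
  by rewrite tnth_virtual_costs tnth_replace; case: eqP => // ->.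
have := virtual_cost_incr (mem_set ss) (mem_set ss') le_s.
rewrite le_eqVlt => /predU1P[eqpsi|ltpsi].
  (* On a flat piece of the virtual cost both profiles have the same virtual costs, and [ystar],
     which sees only these, selects the same solution. *)
  rewrite /y (_ : virtual_costs P C f (replace c i s') = virtual_costs P C f (replace c i s))//.
  by apply: eq_from_tnth => j; rewrite !pE /psi eqpsi.
apply: (solution_monotone (ystar_sol (supports_replace sc ss))
  (ystar_sol (supports_replace sc ss'))).
  by move=> j /negbTE ji; rewrite !pE ji.
by rewrite !pE eqxx.
Qed.

(** Extended by 0 off the supports, whereas the mechanism will charge loss 1 there; true profiles
    lie in the supports almost surely. *)
Definition star_loss i : n.-tuple R -> R := (fun c => y c i) \_ (supports f).

Lemma star_lossE i c : supports f c -> star_loss i c = y c i.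
Proof. by move=> sc; rewrite /star_loss patchE mem_set. Qed.

Lemma star_loss_ge0 i c : 0 <= star_loss i c.
Proof. by apply: restrict_ge0 => {}c sc; have [_ ->] := solution_facts sc. Qed.

Lemma measurable_y i : measurable_fun (supports f) (fun c => y c i).
Proof. exact: (measurableT_comp (measurable_tnth i) ystar_meas). Qed.

Lemma measurable_star_loss i : measurable_fun setT (star_loss i).
Proof. by apply/(measurable_restrictT _ measurable_supports); exact: measurable_y. Qed.

Lemma measurable_solution_mse : measurable_fun (supports f) solution_mse.
Proof.
have mS : measurable_fun (supports f) total.
  by apply: measurable_sum => i; exact: measurable_y.
apply: measurable_funD.
  apply: measurable_funM => //; apply: measurable_sum => i; apply: measurable_funX.
  by apply: measurable_funM; [exact: measurable_y|exact: measurable_funV].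
by apply: measurable_funM => //; apply: measurable_funV; exact: measurable_funX.
Qed.

Let E i := interim C i (star_loss i).

Let E_ge0 i x : (0 <= E i x)%E.
Proof. by apply: interim_ge0 => c; exact: star_loss_ge0. Qed.

Let measurable_E i : measurable_fun setT (E i).
Proof.
apply: measurable_interim; first exact: measurable_star_loss.
exact: star_loss_ge0.
Qed.

Let measurable_star_loss_replace i x :
  measurable_fun setT (fun w => star_loss i (replace (sens w) i x)).
Proof.
by apply: (measurableT_comp (measurable_star_loss i)); exact: measurable_replace_sens.
Qed.

Let E_antitone i s s' : support_of (f i) s -> support_of (f i) s' -> s <= s' ->
  (E i s' <= E i s)%E.
Proof.
move=> ss ss' le_s; apply: (@ae_ge0_le_integral _ _ _ P _ measurableT
  (fun w => (star_loss i (replace (sens w) i s'))%:E)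
  (fun w => (star_loss i (replace (sens w) i s))%:E)).
- by move=> w _; rewrite lee_fin star_loss_ge0.
- exact/measurable_EFinP.
- by move=> w _; rewrite lee_fin star_loss_ge0.
- exact/measurable_EFinP.
apply: filterS sens_supports => w sw _.
by rewrite lee_fin !star_lossE ?solution_antitone//; exact: supports_replace.
Qed.

(* From [s y^3 <= k] one gets [s y^2 <= s + k]. *)
Let E_le i s b : support_of (f i) s -> 0 < s -> s <= b ->
  (E i s <= (Num.sqrt (b + 12 * N) * (Num.sqrt s)^-1)%:E)%E.
Proof.
move=> ss s0 sb.
pose k := Num.sqrt (b + 12 * N) * (Num.sqrt s)^-1.
rewrite -/k.
have k0 : 0 <= k by rewrite mulr_ge0 ?invr_ge0 ?sqrtr_ge0.
apply: (@le_trans _ _ (\int[P]_w (cst k%:E w))%E).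
  apply: (@ae_ge0_le_integral _ _ _ P _ measurableT
    (fun w => (star_loss i (replace (sens w) i s))%:E) (cst k%:E)) => //.
  - by move=> w _; rewrite lee_fin star_loss_ge0.
  - exact/measurable_EFinP.
  apply: filterS sens_supports => w sw _.
  have sr := supports_replace sw ss.
  rewrite /= lee_fin star_lossE//.
  have [_ _ _ _] := solution_bounds i sr.
  have [_ /(_ i) + _ _] := solution_facts sr.
  rewrite tnth_replace eqxx; set z := y _ _ => z0 cube.
  have z2 : s * z ^+ 2 <= b + 12 * N.
    have [z1|z1] := leP z 1.
      have : s * z ^+ 2 <= s * 1 by rewrite ler_pM2l// expr_le1.
      have : 0 <= N by rewrite ler0n.
      lra.
    have : s * z ^+ 2 <= s * z ^+ 3.
      by rewrite ler_pM2l// exprS ler_peMl ?sqr_ge0// ltW.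
    lra.
  have bN0 : 0 <= b + 12 * N by apply: le_trans z2; rewrite mulr_ge0 ?sqr_ge0 ?(ltW s0).
  rewrite /k -(sqrtrV (ltW s0)) -sqrtrM//.
  rewrite -[leLHS]ger0_norm// -sqrtr_sqr ler_wsqrtr// ler_pdivlMr//.
  by rewrite mulrC.
by rewrite integral_cst//= probability_setT mule1.
Qed.

Let E_fin i s : support_of (f i) s -> 0 < s -> E i s \is a fin_num.
Proof.
move=> ss s0; rewrite ge0_fin_numE//.
exact: le_lt_trans (E_le ss s0 (lexx s)) (ltry _).
Qed.

Let rent_split i x x' : support_of (f i) x -> support_of (f i) x' -> x <= x' ->
  (rent (f i) (E i) x =
   \int[lebesgue_measure]_(s in `[x, x'[) E i s + rent (f i) (E i) x')%E.
Proof.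
move=> sx sx' xx'; rewrite /rent.
have -> : support_of (f i) `&` `[x, +oo[ =
    `[x, x'[ `|` (support_of (f i) `&` `[x', +oo[).
  apply/seteqP; split => s /=; rewrite !in_itv/= !andbT.
    move=> [ss xs]; have [sx'_|x's] := ltP s x'; [left|by right].
    by rewrite xs.
  move=> [/andP[xs sx'_]|[ss x's]]; last by split => //; exact: le_trans x's.
  by split => //; apply: (supp_itv sx sx'); rewrite xs ltW.
rewrite ge0_integral_setU//.
- apply: measurableI => //; exact: measurable_support_of (C_density i).
- by apply: measurable_funTS; exact: measurable_E.
- apply/disj_set2P; apply/seteqP; split => // s /=; rewrite !in_itv/= andbT.
  by move=> [/andP[_ sx'_] [_]]; rewrite leNgt sx'_.
Qed.

Let rent_ge0 i x : (0 <= rent (f i) (E i) x)%E.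
Proof. by apply: integral_ge0. Qed.

(** Guaranteed by the existence of a feasible mechanism, and the source of integrability of the
    payments along true profiles. *)
Hypothesis value_lty :
  (\int[P]_w ((solution_value \_ (supports f)) (sens w))%:E < +oo)%E.

Lemma measurable_solution_value : measurable_fun setT (solution_value \_ (supports f)).
Proof.
apply/(measurable_restrictT _ measurable_supports).
apply: (eq_measurable_fun (fun c => N * solution_mse c + \sum_(i < n) psi i (tnth c i) * y c i)).
  by move=> c; rewrite inE => sc; have [_ _ _ ->] := solution_facts sc.
apply: measurable_funD.
  by apply: measurable_funM => //; exact: measurable_solution_mse.
apply: measurable_sum => i; apply: measurable_funM; last exact: measurable_y.
apply: measurableT_comp; first exact: (measurable_virtual_cost C_density).
by apply: measurable_funTS; exact: measurable_tnth.
Qed.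

Let msens : measurable_fun setT sens. Proof. exact: measurable_sensitivities. Qed.

Let value_patchE c : supports f c -> (solution_value \_ (supports f)) c = solution_value c.
Proof. by move=> sc; rewrite patchE mem_set. Qed.

Let value_patch_ge0 c : 0 <= (solution_value \_ (supports f)) c.
Proof. by apply: restrict_ge0 => {}c sc; exact: solution_value_ge0. Qed.

Let dominated (u : T -> R) : measurable_fun setT u ->
  {ae P, forall w, 0 <= u w <= (solution_value \_ (supports f)) (sens w)} ->
  P.-integrable setT (EFin \o u).
Proof.
move=> mu_ ule; apply/integrableP; split; first exact/measurable_EFinP.
apply: le_lt_trans value_lty; apply: ae_ge0_le_integral => //.
- by apply: measurableT_comp => //; exact/measurable_EFinP.
- by move=> w _; rewrite lee_fin.
- by apply/measurable_EFinP; exact: measurableT_comp measurable_solution_value msens.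
by apply: filterS ule => w /andP[u0 uV] _; rewrite /= lee_fin ger0_norm.
Qed.

Let hazard_term_integrable i : P.-integrable setT
  (EFin \o (fun w => hazard C f i (C i w) * star_loss i (sens w))).
Proof.
apply: dominated.
  apply: measurable_funM; last exact: measurableT_comp (measurable_star_loss i) msens.
  by apply: measurableT_comp => //; exact: (measurable_hazard C_density).
apply: filterS sens_supports => w sw; have [_ _ + _ _] := solution_bounds i sw.
rewrite tnth_sens star_lossE// value_patchE// => ->.
by rewrite mulr_ge0 ?(hazard_ge0 C_density)//; have [_ ->] := solution_facts sw.
Qed.

Let expected_rent i : (\int[P]_w rent (f i) (E i) (C i w) =
  \int[P]_w (hazard C f i (C i w) * star_loss i (sens w))%:E)%E.
Proof.
apply: (integral_interim_rent C_ge0 C_density (C_indep ZC_indep)).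
  exact: measurable_star_loss.
exact: star_loss_ge0.
Qed.

Let measurable_rentE i : measurable_fun setT (rent (f i) (E i)).
Proof. exact: (measurable_rent (C_density i) (measurable_E i) (E_ge0 i)). Qed.

Let rent_integrable i : P.-integrable setT (fun w => rent (f i) (E i) (C i w)).
Proof.
apply/integrableP; split; first exact: measurableT_comp (measurable_rentE i) _.
under eq_integral do rewrite gee0_abs//.
rewrite expected_rent.
have /integrableP[_] := hazard_term_integrable i.
apply: le_lt_trans; apply: ge0_le_integral => //.
- by move=> w _; rewrite lee_fin mulr_ge0 ?(hazard_ge0 C_density) ?star_loss_ge0.
- exact: measurable_int (hazard_term_integrable i).
- by apply: measurableT_comp => //; exact: measurable_int (hazard_term_integrable i).
- by move=> w _; rewrite lee_fin ler_norm.
Qed.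

(** Integrability yields a finite rent at some [x0 > 0] of the support, hence at all larger points.
    To its left the rent grows by an integral of the interim loss, finite by the inverse square root
    bound even when [x = 0]. *)
Lemma rent_fin i x : support_of (f i) x -> rent (f i) (E i) x \is a fin_num.
Proof.
move=> sx.
have [x0 [x0_gt0 sx0 rx0]] : exists x0, [/\ 0 < x0, support_of (f i) x0 &
    rent (f i) (E i) x0 \is a fin_num].
  have aefin := integrable_ae measurableT (rent_integrable i).
  have aesupp := density_support (C_density i) (C_ge0 i).
  have /ae_exists[w [[w0 sw] rw]] : {ae P, forall w,
      (0 < C i w /\ support_of (f i) (C i w)) /\ rent (f i) (E i) (C i w) \is a fin_num}.
    by apply: filterS2 aesupp aefin => w h1 h2; split => //; exact: h2.
  by exists (C i w).
rewrite ge0_fin_numE//.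
have [x0x|xx0] := leP x0 x.
  apply: le_lt_trans (_ : _ <= rent (f i) (E i) x0)%E _; last by rewrite ltey_eq rx0.
  by rewrite (rent_split sx0 sx x0x) leeDr// integral_ge0.
rewrite (rent_split sx sx0 (ltW xx0)) lte_add_pinfty//; last by rewrite ltey_eq rx0.
have x_ge0 : 0 <= x by case: sx.
pose k := Num.sqrt (x0 + 12 * N).
have k0 : 0 <= k by exact: sqrtr_ge0.
apply: (@le_lt_trans _ _ (k%:E * (2 * Num.sqrt x0)%:E)%E); last by rewrite -EFinM ltry.
apply: le_trans (lee_wpmul2l (_ : (0 <= k%:E)%E) (integral_inv_sqrt_le x0_gt0)); last first.
  by rewrite lee_fin.
have minv A : measurable_fun A (fun s : R => ((Num.sqrt s)^-1)%:E).
  by apply/measurable_EFinP; apply: measurable_funTS; exact: measurable_inv_sqrt.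
have inv0 (s : R) : (0 <= ((Num.sqrt s)^-1)%:E)%E by rewrite lee_fin invr_ge0 sqrtr_ge0.
rewrite -ge0_integralZl//; last exact: minv.
rewrite -[leLHS]integral_itv_obnd_cbnd; last by apply: measurable_funTS; exact: measurable_E.
apply: (@le_trans _ _ (\int[lebesgue_measure]_(s in `]x, x0[) (k%:E * ((Num.sqrt s)^-1)%:E))%E).
  apply: ge0_le_integral => //.
  - by apply: measurable_funTS; exact: measurable_E.
  - by apply: emeasurable_funM => //; exact: minv.
  move=> s /=; rewrite in_itv/= => /andP[xs sx0_].
  rewrite -EFinM; apply: E_le (ltW sx0_); last exact: le_lt_trans xs.
  by apply: (supp_itv sx sx0); rewrite !ltW.
apply: ge0_subset_integral => //.
- by apply: emeasurable_funM => //; exact: minv.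
- by move=> s _; rewrite mule_ge0.
- move=> s /=; rewrite !in_itv/= => /andP[xs /ltW ->].
  by rewrite (le_lt_trans x_ge0).
Qed.

Let H i x : R := fine (rent (f i) (E i) x).
Let mse' := solution_mse \_ (supports f).
Let rent' i := (fun c => H i (tnth c i)) \_ (supports f).

(* Off the supports, reports are punished with the outside option. *)
Definition optimal_mechanism : mechanism R n := Mechanism
  (fun c => [tuple if c \in supports f then y c i else 1 | i < n])
  (fun c => [tuple if c \in supports f
     then solution_mse c + tnth c i * y c i + H i (tnth c i) - VAR else - VAR | i < n])
  (fun c => [tuple if c \in supports f then y c i / total c else n%:R^-1 | i < n])
  (fun c => if c \in supports f then total c else n%:R).
Local Notation Mstar := optimal_mechanism.

Let nR0 : 0 < n%:R :> R. Proof. by rewrite ltr0n. Qed.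

Let H0 i x : 0 <= H i x. Proof. by rewrite fine_ge0// rent_ge0. Qed.

(** On the supports [total c * (y c i / total c)] is exactly the loss [y c i]; elsewhere equal
    weights [n^-1] with noise parameter [n] match the loss 1. *)
Let star_constraints c : [/\ orthant (loss Mstar c),
  \sum_(i < n) tnth (weight Mstar c) i = 1, 0 < noise Mstar c &
  forall i, noise Mstar c * tnth (weight Mstar c) i <= tnth (loss Mstar c) i].
Proof.
rewrite /=; have [|_] := boolP (c \in supports f).
  rewrite inE => sc; have [S0 y0 _ _] := solution_facts sc.
  split => //.
  - by move=> i; rewrite tnth_mktuple.
  - under eq_bigr do rewrite tnth_mktuple.
    by rewrite -mulr_suml divff// gt_eqF.
  - by move=> i; rewrite !tnth_mktuple mulrCA divff ?mulr1// gt_eqF.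
split => //.
- by move=> i; rewrite tnth_mktuple.
- under eq_bigr do rewrite tnth_mktuple.
  by rewrite sumr_const card_ord -[_ *+ n]mulr_natr mulVf// gt_eqF.
- by move=> i; rewrite !tnth_mktuple mulfV// gt_eqF.
Qed.

Let MSE_starE c : supports f c -> MSE P theta Z Mstar c = solution_mse c.
Proof.
move=> sc; have [_ w1 eta0 _] := star_constraints c.
rewrite (MSE_formula _ Z_mean Z_var Z_bound (Z_indep ZC_indep))//=.
rewrite mem_set// /solution_mse; congr (_ * _ + _).
by apply: eq_bigr => i _; rewrite tnth_mktuple.
Qed.

Let MSE_star_ge0 c : 0 <= MSE P theta Z Mstar c.
Proof.
have [_ w1 eta0 _] := star_constraints c.
rewrite (MSE_formula _ Z_mean Z_var Z_bound (Z_indep ZC_indep))//.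
rewrite addr_ge0 ?divr_ge0 ?sqr_ge0// mulr_ge0// sumr_ge0// => i _; exact: sqr_ge0.
Qed.

Let measurable_if (g : n.-tuple R -> R) (k : R) : measurable_fun (supports f) g ->
  measurable_fun setT (fun c => if c \in supports f then g c else k).
Proof.
move=> mg.
rewrite (_ : (fun _ => _) = (fun c => (g \_ (supports f)) c + k * \1_(~` supports f) c)).
  apply: measurable_funD; first exact/(measurable_restrictT _ measurable_supports).
  by apply: measurable_funM => //; apply: measurable_indic; exact: measurableC measurable_supports.
apply/funext => c; rewrite patchE indicE in_setC.
by case: (c \in _); rewrite ?mulr0 ?addr0 ?add0r ?mulr1.
Qed.

Let measurable_tuple_if (g : n.-tuple R -> 'I_n -> R) (k : R) :
  (forall i, measurable_fun (supports f) (g ^~ i)) ->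
  measurable_fun setT (fun c => [tuple if c \in supports f then g c i else k | i < n]).
Proof.
move=> mg; apply: measurable_fun_tuple => i.
by under eq_fun do rewrite tnth_mktuple; exact: measurable_if.
Qed.

Let measurable_H i : measurable_fun setT (H i).
Proof. by apply: measurableT_comp => //; exact: measurable_rentE. Qed.

Let measurable_total : measurable_fun (supports f) total.
Proof. by apply: measurable_sum => i; exact: measurable_y. Qed.

Let paymentE c i : tnth (payment Mstar c) i =
  mse' c + tnth c i * star_loss i c + rent' i c - VAR.
Proof.
rewrite tnth_mktuple /mse' /star_loss /rent' !patchE.
by case: (c \in _); rewrite ?mulr0 ?addr0 ?add0r.
Qed.

Let mse'_ge0 c : 0 <= mse' c.
Proof. by apply: restrict_ge0 => {}c _; exact: solution_mse_ge0. Qed.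

Let rent'_ge0 i c : 0 <= rent' i c.
Proof. by apply: restrict_ge0 => {}c _; exact: H0. Qed.

Let measurable_mse' : measurable_fun setT mse'.
Proof.
by apply/(measurable_restrictT _ measurable_supports); exact: measurable_solution_mse.
Qed.

Let measurable_rent' i : measurable_fun setT (rent' i).
Proof.
apply/(measurable_restrictT _ measurable_supports).
apply: (measurableT_comp (measurable_H i)).
by apply: measurable_funTS; exact: measurable_tnth.
Qed.

Let integrable_payment (g : T -> n.-tuple R) i :
  measurable_fun setT g -> (forall w, 0 <= tnth (g w) i) ->
  P.-integrable setT (EFin \o (fun w => mse' (g w))) ->
  P.-integrable setT (EFin \o (fun w => tnth (g w) i * star_loss i (g w))) ->
  P.-integrable setT (EFin \o (fun w => rent' i (g w))) ->
  P.-integrable setT (fun w => (tnth (payment Mstar (g w)) i)%:E).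
Proof.
move=> mg g0 i1 i2 i3.
rewrite (_ : (fun w => _) = (EFin \o (fun w => mse' (g w)))
    \+ (EFin \o (fun w => tnth (g w) i * star_loss i (g w))%R)
    \+ (EFin \o (fun w => rent' i (g w))) \+ (EFin \o cst (- VAR)%R))%E.
  apply: integrableD => //; last exact: finite_measure_integrable_cst.
  by apply: integrableD => //; exact: integrableD.
by apply/funext => w; rewrite paymentE /= !EFinD.
Qed.

Let integrable_mse' : P.-integrable setT (EFin \o (fun w => mse' (sens w))).
Proof.
apply: dominated; first exact: measurableT_comp measurable_mse' msens.
apply: filterS sens_supports => w sw.
rewrite mse'_ge0 /= value_patchE// /mse' patchE mem_set//.
have [_ _ _ ->] := solution_facts sw.
have m0 := solution_mse_ge0 (sens w).
have : solution_mse (sens w) <= N * solution_mse (sens w) by rewrite ler_peMl// ler1n.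
have : 0 <= \sum_(i < n) psi i (tnth (sens w) i) * y (sens w) i.
  rewrite sumr_ge0// => i _; have [_ y0 p0 _] := solution_facts sw.
  by rewrite mulr_ge0//; have := p0 i; rewrite tnth_virtual_costs.
lra.
Qed.

Let integrable_cost_term i :
  P.-integrable setT (EFin \o (fun w => tnth (sens w) i * star_loss i (sens w))).
Proof.
apply: dominated.
  apply: measurable_funM; first exact: measurable_tnth_sens.
  exact: measurableT_comp (measurable_star_loss i) msens.
apply: filterS sens_supports => w sw; have [_ _ _ + _] := solution_bounds i sw.
rewrite star_lossE// value_patchE// => ->.
by rewrite mulr_ge0//; [case: (sw i)|have [_ ->] := solution_facts sw].
Qed.

Let rent_H i w : support_of (f i) (C i w) -> (H i (C i w))%:E = rent (f i) (E i) (C i w).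
Proof. by move=> sw; rewrite /H fineK// rent_fin. Qed.

Let integrable_rent' i : P.-integrable setT (EFin \o (fun w => rent' i (sens w))).
Proof.
apply: (le_integrable measurableT _ _ (rent_integrable i)).
  by apply/measurable_EFinP; exact: measurableT_comp (measurable_rent' i) msens.
move=> w _; rewrite gee0_abs ?lee_fin// gee0_abs//=.
rewrite /rent' patchE; have [|_] := boolP (_ \in _); last exact: rent_ge0.
by rewrite inE => sw; have := sw i; rewrite tnth_sens => sCw; rewrite rent_H.
Qed.

(** Bounds free of the other users' reports: finiteness of the expected value of the program does
    not by itself control a profile in which one report is fixed. *)
Let replace_bound i x w :
  mse' (replace (sens w) i x) <= `|N * (2 + VAR) + psi i x| /\
  x * star_loss i (replace (sens w) i x) <= `|N * (2 + VAR) + psi i x|.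
Proof.
rewrite /mse' /star_loss !patchE; have [|_] := boolP (_ \in _); last by rewrite mulr0; split; exact: normr_ge0.
rewrite inE => sr; have [+ + _ _ _] := solution_bounds i sr.
by rewrite !tnth_replace eqxx => h1 h2; split; apply: le_trans (ler_norm _).
Qed.

Lemma optimal_is_mechanism : is_mechanism C Mstar.
Proof.
split.
- split; apply: measurable_funTS => /=.
  + by apply: measurable_tuple_if => i; exact: measurable_y.
  + apply: measurable_tuple_if => i.
    apply: measurable_funB => //; apply: measurable_funD.
      apply: measurable_funD; first exact: measurable_solution_mse.
      by apply: measurable_funM; [apply: measurable_funTS; exact: measurable_tnth|exact: measurable_y].
    apply: (measurableT_comp (measurable_H i)).
    by apply: measurable_funTS; exact: measurable_tnth.
  + apply: measurable_tuple_if => i; apply: measurable_funM; first exact: measurable_y.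
    exact: measurable_funV measurable_total.
  + exact: measurable_if.
- by move=> c _; exact: star_constraints.
- move=> i; apply: integrable_payment => //.
  by move=> w; rewrite tnth_sens.
- move=> i x x0; have mr := measurable_replace_sens C i x.
  apply: integrable_payment => //.
  + by move=> w; rewrite tnth_replace eqxx.
  + apply: (@bounded_integrable _ _ _ P _ (`|N * (2 + VAR) + psi i x|)).
      exact: measurableT_comp measurable_mse' mr.
    by move=> w; rewrite ger0_norm//; have [] := replace_bound i x w.
  + apply: (@bounded_integrable _ _ _ P _ (`|N * (2 + VAR) + psi i x|)).
      apply: measurable_funM; last exact: measurableT_comp (measurable_star_loss i) mr.
      exact: (measurableT_comp (measurable_tnth i) mr).
    move=> w; rewrite tnth_replace eqxx ger0_norm ?mulr_ge0 ?star_loss_ge0//.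
    by have [] := replace_bound i x w.
  + apply: (@bounded_integrable _ _ _ P _ (H i x)).
      exact: measurableT_comp (measurable_rent' i) mr.
    move=> w; rewrite ger0_norm// /rent' patchE tnth_replace eqxx.
    by case: ifP.
Qed.

Let measurable_loss_star i : measurable_fun setT (fun c => tnth (loss Mstar c) i).
Proof.
by under eq_fun do rewrite tnth_mktuple; apply: measurable_if; exact: measurable_y.
Qed.

Let measurable_payment_star i : measurable_fun setT (fun c => tnth (payment Mstar c) i).
Proof.
under eq_fun do rewrite paymentE.
apply: measurable_funB => //; apply: measurable_funD => //; apply: measurable_funD => //.
by apply: measurable_funM; [exact: measurable_tnth|exact: measurable_star_loss].
Qed.

Let measurable_MSE_star (g : T -> n.-tuple R) : measurable_fun setT g ->
  (forall w, orthant (g w)) -> measurable_fun setT (fun w => MSE P theta Z Mstar (g w)).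
Proof.
move=> mg og; rewrite (_ : (fun w => _) = ((MSE P theta Z Mstar) \_ orthant) \o g).
  apply: measurableT_comp => //; apply/(measurable_restrictT _ measurable_orthant).
  exact: (measurable_MSE _ Z_mean Z_var Z_bound ZC_indep optimal_is_mechanism).
by apply/funext => w; rewrite /= patchE mem_set.
Qed.

(** The payment refunds the mean squared error and the privacy cost at the reported sensitivity, so
    that only the misreport term, [VAR] and the rent at the report survive. *)
Let COST_star_on i x' x : support_of (f i) x' -> 0 <= x ->
  COST P theta Z C Mstar i x' x =
  (\int[P]_w ((x - x') * star_loss i (replace (sens w) i x') + (VAR - H i x'))%:E)%E.
Proof.
move=> sx' x0; rewrite /COST unlock; have [x'0 _] := sx'.
have mr := measurable_replace_sens C i x'.
have orep w : orthant (replace (sens w) i x').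
  by apply: orthant_replace => //; exact: orthant_sens.
apply: ae_eq_integral => //.
- apply/measurable_EFinP; apply: measurable_funB; first apply: measurable_funD.
  + exact: measurable_MSE_star.
  + apply: measurable_funM => //.
    exact: (measurableT_comp (measurable_loss_star i) mr).
  + exact: (measurableT_comp (measurable_payment_star i) mr).
- apply/measurable_EFinP; apply: measurable_funD => //; apply: measurable_funM => //.
- apply: filterS sens_supports => w sw _ /=.
  have sr := supports_replace sw sx'.
  rewrite MSE_starE// paymentE star_lossE// tnth_mktuple mem_set//.
  rewrite /mse' /rent' !patchE mem_set// tnth_replace eqxx; congr EFin; lra.
Qed.

(** The side condition deals with [E i 0], which may be infinite. When [x' <= x] the loss has a
    nonnegative coefficient and the formula holds in the extended reals; otherwise [x' > 0] makes
    [E i x'] finite. *)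
Let COST_starE i x' x : support_of (f i) x' -> 0 <= x -> x' <= x \/ 0 < x' ->
  COST P theta Z C Mstar i x' x = ((x - x')%:E * E i x' + (VAR - H i x')%:E)%E.
Proof.
move=> sx' x0 cond; rewrite COST_star_on//.
have mr := measurable_star_loss_replace i x'.
have [x'x|xx'] := leP x' x.
  have -> : (\int[P]_w ((x - x') * star_loss i (replace (sens w) i x') + (VAR - H i x'))%:E =
      \int[P]_w ((x - x') * star_loss i (replace (sens w) i x') - (cst (H i x' - VAR)) w)%:E)%E.
    by apply: eq_integral => w _; congr EFin; rewrite /=; lra.
  rewrite ge0_integralB_EFin; last 3 first.
  - exact: measurable_funM.
  - by move=> w; rewrite mulr_ge0 ?star_loss_ge0// subr_ge0.
  - exact: finite_measure_integrable_cst.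
  rewrite [X in (_ - X)%E]/= integral_cst//= probability_setT mule1 -EFinN opprB.
  congr (_ + _)%E; rewrite -ge0_integralZl//.
  - exact/measurable_EFinP.
  - by move=> w _; rewrite lee_fin star_loss_ge0.
  - by rewrite lee_fin subr_ge0.
have x'0 : 0 < x' by case: cond => //; rewrite leNgt xx'.
have iE : P.-integrable setT (fun w => (star_loss i (replace (sens w) i x'))%:E).
  apply/integrableP; split; first exact/measurable_EFinP.
  under eq_integral do rewrite gee0_abs ?lee_fin ?star_loss_ge0//.
  by rewrite -/(E i x') ltey_eq E_fin.
under eq_integral do rewrite EFinD EFinM.
rewrite integralD//; last 2 first.
- exact: integrableZl.
- exact: finite_measure_integrable_cst.
by rewrite integralZl// integral_cst//= probability_setT mule1.
Qed.

Let COST_star_self i x : support_of (f i) x ->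
  COST P theta Z C Mstar i x x = (VAR - H i x)%:E.
Proof.
move=> sx; have [x0 _] := sx.
by rewrite COST_starE//; [rewrite subrr mul0e add0e|left].
Qed.

(** One report outside its support takes the whole profile out of [supports f], whatever the others
    report. The user then pays [VAR] on top of nonnegative costs. *)
Let COST_star_off i x' x : 0 <= x' -> 0 <= x -> ~ support_of (f i) x' ->
  (VAR%:E <= COST P theta Z C Mstar i x' x)%E.
Proof.
move=> x'0 x0 nsx'; rewrite /COST unlock.
have nsr w : replace (sens w) i x' \notin supports f.
  by rewrite notin_setE => /(_ i); rewrite tnth_replace eqxx.
apply: (@le_trans _ _ (\int[P]_w (cst VAR%:E w))%E).
  by rewrite integral_cst//= probability_setT mule1.
apply: ge0_le_integral => //.
- apply/measurable_EFinP; have mr := measurable_replace_sens C i x'.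
  apply: measurable_funB; first apply: measurable_funD.
  + apply: measurable_MSE_star => // w.
    by apply: orthant_replace => //; exact: orthant_sens.
  + apply: measurable_funM => //.
    exact: (measurableT_comp (measurable_loss_star i) mr).
  + exact: (measurableT_comp (measurable_payment_star i) mr).
- move=> w _; rewrite /= lee_fin !tnth_mktuple (negbTE (nsr w)) opprK.
  by rewrite lerDr addr_ge0 ?MSE_star_ge0// mulr1.
Qed.

Let integral_E_itv_le i x x' : support_of (f i) x -> support_of (f i) x' -> x <= x' ->
  ((x' - x)%:E * E i x' <= \int[lebesgue_measure]_(s in `[x, x'[) E i s <= (x' - x)%:E * E i x)%E.
Proof.
move=> sx sx' xx'.
have cstE (k : \bar R) : ((x' - x)%:E * k = \int[lebesgue_measure]_(s in `[x, x'[) cst k s)%E.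
  rewrite integral_cst//= lebesgue_measure_itv/= lte_fin muleC.
  case: ltP => [_|x'x]; first by rewrite EFinB.
  have -> : x' = x by apply: le_anti; rewrite x'x xx'.
  by rewrite subrr.
have sin s : x <= s -> s < x' -> support_of (f i) s.
  by move=> xs sx'_; apply: (supp_itv sx sx'); rewrite xs ltW.
have mE A : measurable_fun A (E i) by apply: measurable_funTS; exact: measurable_E.
rewrite !cstE; apply/andP; split; apply: ge0_le_integral => //.
- by move=> s _; exact: E_ge0.
- exact: mE.
- move=> s /=; rewrite in_itv/= => /andP[xs sx'_].
  by apply: E_antitone => //; [exact: sin|exact: ltW].
- exact: mE.
- move=> s /=; rewrite in_itv/= => /andP[xs sx'_].
  by apply: E_antitone => //; exact: sin.
Qed.

(** The rents at [x] and [x'] differ by the integral of the nonincreasing [E i] between them, while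
    a misreport changes the privacy cost by [(x - x') * E i x']; comparing the integral with this
    endpoint value settles both directions. Individual rationality is the nonnegativity of the
    rent. *)
Lemma optimal_feasible : feasible P theta VAR Z C f Mstar.
Proof.
split; first exact: optimal_is_mechanism.
- move=> i x x' sx x'0; have [x0 _] := sx.
  rewrite COST_star_self//.
  have [sx'|nsx'] := pselect (support_of (f i) x'); last first.
    by apply: le_trans (COST_star_off _ _ nsx') => //; rewrite lee_fin gerBl.
  have HE z : support_of (f i) z -> (H i z)%:E = rent (f i) (E i) z.
    by move=> sz; rewrite /H fineK// rent_fin.
  have [x'x|xx'] := leP x' x.
    rewrite COST_starE//; last by left.
    have /andP[_] := integral_E_itv_le sx' sx x'x; have := rent_split sx' sx x'x.
    rewrite -!HE// => HH; set I := (\int[_]_(_ in _) _)%E in HH *.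
    have -> : I = (H i x' - H i x)%:E by rewrite EFinB HH addeK.
    move=> /(leeD2r (VAR - H i x')%:E); apply: le_trans.
    by rewrite -EFinD lee_fin; lra.
  have x'gt0 : 0 < x' by exact: le_lt_trans xx'.
  rewrite COST_starE//; last by right.
  have /andP[+ _] := integral_E_itv_le sx sx' (ltW xx').
  have := rent_split sx sx' (ltW xx').
  rewrite -!HE// => HH; set I := (\int[_]_(_ in _) _)%E in HH *.
  have -> : I = (H i x - H i x')%:E by rewrite EFinB HH addeK.
  by rewrite -(fineK (E_fin sx' x'gt0)) -!EFinM -!EFinD !lee_fin; lra.
- by move=> i x sx; rewrite COST_star_self// lee_fin gerBl.
Qed.

Lemma optimal_platform_cost : platform_cost theta Z C Mstar =
  (\int[P]_w ((solution_value \_ (supports f)) (sens w))%:E - (n%:R * VAR)%:E)%E.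
Proof.
pose cterm w := \sum_(i < n) tnth (sens w) i * star_loss i (sens w).
pose rterm w := \sum_(i < n) rent' i (sens w).
pose hterm w := \sum_(i < n) hazard C f i (C i w) * star_loss i (sens w).
have intsum (g : 'I_n -> T -> R) : (forall i, P.-integrable setT (EFin \o g i)) ->
    P.-integrable setT (EFin \o (fun w => \sum_(i < n) g i w)) /\
    (\int[P]_w (\sum_(i < n) g i w)%:E = \sum_(i < n) \int[P]_w (g i w)%:E)%E.
  move=> ig; have gE : EFin \o (fun w => \sum_(i < n) g i w) =
      (fun w => \sum_(i < n) (g i w)%:E)%E.
    by apply/funext => w; rewrite /= sumEFin.
  split; first by rewrite gE; apply: integrable_sum => // i _; exact: ig.
  rewrite -integral_sum//.
  by apply: eq_integral => w _; rewrite sumEFin.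
have [icterm _] := intsum (fun i w => tnth (sens w) i * star_loss i (sens w)) integrable_cost_term.
have [irterm Erterm] := intsum (fun i w => rent' i (sens w)) integrable_rent'.
have [ihterm Ehterm] := intsum (fun i w => hazard C f i (C i w) * star_loss i (sens w))
  hazard_term_integrable.
(* Rents and hazard terms agree only in expectation; the remaining parts of the identity are
   compared pointwise on the supports. *)
have rhE : (\int[P]_w (rterm w)%:E = \int[P]_w (hterm w)%:E)%E.
  rewrite /rterm /hterm Erterm Ehterm; apply: eq_bigr => i _.
  rewrite -expected_rent; apply: ae_eq_integral => //.
  - exact: measurable_int (integrable_rent' i).
  - exact: measurable_int (rent_integrable i).
  - apply: filterS sens_supports => w sw _.
    by rewrite /rent' patchE mem_set//= tnth_sens rent_H//; have := sw i; rewrite tnth_sens.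
have mN : P.-integrable setT (EFin \o (fun w => N * mse' (sens w))).
  rewrite (_ : EFin \o _ = (fun w => N%:E * (mse' (sens w))%:E)%E).
    by apply: integrableZl => //; exact: integrable_mse'.
  by apply/funext => w; rewrite /= EFinM.
have iNc : P.-integrable setT (EFin \o (fun w => N * mse' (sens w) + cterm w)).
  rewrite (_ : EFin \o _ = (EFin \o (fun w => N * mse' (sens w))%R) \+ (EFin \o cterm))%E.
    exact: integrableD.
  by apply/funext.
have EV : (\int[P]_w ((solution_value \_ (supports f)) (sens w))%:E =
    \int[P]_w (N * mse' (sens w) + cterm w)%:E + \int[P]_w (hterm w)%:E)%E.
  rewrite -integralD_EFin//; apply: ae_eq_integral => //.
  - by apply/measurable_EFinP; exact: measurableT_comp measurable_solution_value msens.
  - apply: measurable_int (integrableD _ iNc ihterm) => //.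
  - apply: filterS sens_supports => w sw _.
    rewrite value_patchE//=; have [_ _ _ ->] := solution_facts sw.
    rewrite -EFinD /mse' patchE mem_set// -addrA; congr (_ + _)%:E.
    rewrite -big_split; apply: eq_bigr => i _ /=.
    by rewrite star_lossE// tnth_sens /psi virtual_costE mulrDl.
rewrite EV -rhE /platform_cost unlock.
transitivity (\int[P]_w ((EFin \o (fun w => N * mse' (sens w) + cterm w)%R) w
    + (EFin \o (fun w => rterm w - n%:R * VAR)%R) w))%E; last first.
  have iq : P.-integrable setT (EFin \o (fun w => rterm w - n%:R * VAR)).
    rewrite (_ : EFin \o _ = (EFin \o rterm) \- (EFin \o cst (n%:R * VAR)%R))%E.
      by apply: integrableB => //; exact: finite_measure_integrable_cst.
    by apply/funext => w; rewrite /= EFinB.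
  rewrite integralD_EFin// -addeA; congr (_ + _)%E.
  transitivity (\int[P]_w ((EFin \o rterm) w - (EFin \o cst (n%:R * VAR)%R) w))%E.
    by apply: eq_integral => w _; rewrite /= EFinB.
  rewrite integralB_EFin//; last exact: finite_measure_integrable_cst.
  by rewrite [X in (_ - X)%E]/= integral_cst//= probability_setT mule1.
have mstar : measurable_fun setT (fun w => MSE P theta Z Mstar (sens w)).
  by apply: measurable_MSE_star => // w; exact: orthant_sens.
apply: ae_eq_integral => //.
- apply/measurable_EFinP; apply: measurable_funD => //; apply: measurable_sum => i.
  exact: (measurableT_comp (measurable_payment_star i) msens).
- apply: emeasurable_funD; first exact: measurable_int iNc.
  apply/measurable_EFinP; apply: measurable_funB => //.
  exact/measurable_EFinP/(measurable_int _ irterm).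
- apply: filterS sens_supports => w sw _ /=.
  rewrite MSE_starE// -EFinD; congr EFin.
  under eq_bigr do rewrite paymentE.
  rewrite !big_split/= !sumr_const card_ord /cterm /rterm.
  have -> : mse' (sens w) = solution_mse (sens w) by rewrite /mse' patchE mem_set.
  have NE : N = n%:R + 1 by rewrite natr1.
  move: (solution_mse _) (\sum_(i < n) _) (\sum_(i < n) _) => a s1 s2.
  rewrite -[a *+ n]mulr_natl -[- VAR *+ n]mulr_natl NE; ring.
Qed.

End optimal_mechanism.

(** * Optimality, and identification of every optimal mechanism *)

Section optimality.
Context {d : measure_display} {T : measurableType d} {R : realType}
  (P : probability T R) {n : nat} (theta VAR : R)
  (Z C : 'I_n -> {RV P >-> R}) (f : 'I_n -> R -> R)
  (ystar : n.-tuple R -> n.-tuple R).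
Hypotheses (n_gt0 : (0 < n)%N)
  (Z_mean : forall i, ('E_P[Z i] = 0)%E)
  (Z_var : forall i, ('V_P[Z i] = VAR%:E)%E)
  (Z_bound : forall i w, `|Z i w| <= 2^-1)
  (C_ge0 : forall i w, 0 <= C i w)
  (C_density : forall i, has_density P (C i) (f i))
  (ZC_indep : mutually_independent P
    (fun k : 'I_n + 'I_n => match k with inl i => Z i : T -> R | inr i => C i end))
  (supp_itv : forall i, is_interval (support_of (f i)))
  (virtual_cost_incr : forall i,
    {in support_of (f i) &, {homo virtual_cost P (C i) (f i) : x y / x <= y}})
  (ystar_meas : measurable_fun (supports f)
    (fun c => ystar (virtual_costs P C f c)))
  (ystar_sol : forall c, supports f c ->
    is_solution VAR (virtual_costs P C f c) (ystar (virtual_costs P C f c))).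
Local Notation sens := (sensitivities C).
Local Notation value := (solution_value VAR C f ystar).
Local Notation total := (virtual_total theta Z C f).
Implicit Types (M : mechanism R n) (c : n.-tuple R).

(** The clipped vector [y] has cost between the value of the program and [total M c]. If these two
    meet, [y] is a solution and the equality case of clipping identifies [loss M c] with it;
    positive sensitivities ensure positive virtual costs. *)
Lemma solution_value_le M c : is_mechanism C M -> supports f c ->
  value c <= total M c /\
  (total M c <= value c -> (forall i, 0 < tnth c i) ->
   is_solution VAR (virtual_costs P C f c) (loss M c) /\
   forall i, tnth (weight M c) i = tnth (loss M c) i / \sum_(j < n) tnth (loss M c) j).
Proof.
move=> mM sc; have [_ /(_ c (supports_orthant sc)) [l0 w1 eta0 wl] _ _] := mM.
have [_ _ p0 _] := solution_facts C_density ystar_sol sc.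
have VAR0 := VAR_ge0 n_gt0 Z_var.
have totE : total M c = n.+1%:R *
    (VAR * (\sum_(i < n) tnth (weight M c) i ^+ 2) + 2 / noise M c ^+ 2)
    + \sum_(i < n) tnth (virtual_costs P C f c) i * tnth (loss M c) i.
  rewrite /virtual_total (MSE_mechanismE _ Z_mean Z_var Z_bound ZC_indep mM)//.
  exact: supports_orthant.
have [_ vmin] := ystar_sol sc.
have [y [ydom]] := program_cost_clip VAR0 p0 l0 w1 eta0 wl.
rewrite -totE => y_le y_eq; split; first exact: le_trans (vmin _ ydom) y_le.
move=> tot_le c0; have p_gt0 i : 0 < tnth (virtual_costs P C f c) i.
  by rewrite tnth_virtual_costs; apply: lt_le_trans (c0 i) (psi_ge C_density i _).
have yE := y_eq (le_trans tot_le (vmin _ ydom)) p_gt0.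
have -> : loss M c = y by apply: eq_from_tnth => i; have [] := yE i.
split; last by move=> i; have [_] := yE i.
split => // z zdom; apply: le_trans (vmin _ zdom).
exact: le_trans y_le tot_le.
Qed.

Let msens : measurable_fun setT sens. Proof. exact: measurable_sensitivities. Qed.

Lemma measurable_virtual_total M : is_mechanism C M ->
  measurable_fun setT (fun w => total M (sens w)).
Proof.
move=> mM; have [[ml _ _ _] _ _ _] := mM.
have mtot : measurable_fun orthant (total M).
  apply: measurable_funD.
    apply: measurable_funM => //.
    exact: (measurable_MSE _ Z_mean Z_var Z_bound ZC_indep mM).
  apply: measurable_sum => i; apply: measurable_funM; last first.
    exact: (measurableT_comp (measurable_tnth i) ml).
  under eq_fun do rewrite tnth_virtual_costs.
  apply: measurableT_comp; first exact: (measurable_virtual_cost C_density).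
  by apply: measurable_funTS; exact: measurable_tnth.
rewrite (_ : (fun w => _) = ((total M) \_ orthant) \o sens).
  by apply: measurableT_comp => //; apply/(measurable_restrictT _ measurable_orthant).
by apply/funext => w; rewrite /= patchE mem_set//; exact: orthant_sens.
Qed.

Lemma virtual_total_ge0 M w : is_mechanism C M -> 0 <= total M (sens w).
Proof.
move=> mM; have ow := orthant_sens C_ge0 w.
have [_ /(_ _ ow)[l0 _ _ _] _ _] := mM.
rewrite addr_ge0 ?mulr_ge0 ?ler0n//.
  exact: (MSE_mechanism_ge0 _ n_gt0 Z_mean Z_var Z_bound ZC_indep).
rewrite sumr_ge0// => i _; rewrite mulr_ge0 ?l0// tnth_virtual_costs.
exact: (virtual_cost_ge0 C_density).
Qed.

Local Notation value' := (value \_ (supports f)).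

Let value'_ge0 c : 0 <= value' c.
Proof.
apply: restrict_ge0 => {}c sc.
exact: (solution_value_ge0 n_gt0 Z_var C_density ystar_sol).
Qed.

Let measurable_value' : measurable_fun setT (fun w => value' (sens w)).
Proof.
exact: measurableT_comp (measurable_solution_value C_density ystar_meas ystar_sol) msens.
Qed.

Lemma integral_solution_value_le M : is_mechanism C M ->
  (\int[P]_w (value' (sens w))%:E <= \int[P]_w (total M (sens w))%:E)%E.
Proof.
move=> mM; apply: (@ae_ge0_le_integral _ _ _ P _ measurableT
    (fun w => (value' (sens w))%:E) (fun w => (total M (sens w))%:E)).
- by move=> w _; rewrite lee_fin.
- exact/measurable_EFinP.
- by move=> w _; rewrite lee_fin virtual_total_ge0.
- by apply/measurable_EFinP; exact: measurable_virtual_total.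
apply: filterS (sens_supports C_ge0 C_density) => w sw _.
by rewrite lee_fin patchE mem_set//; have [] := solution_value_le mM sw.
Qed.

Lemma solution_value_lty M : feasible P theta VAR Z C f M ->
  (\int[P]_w (value' (sens w))%:E < +oo)%E.
Proof.
move=> fM; have [mM _ _] := fM.
apply: le_lt_trans (integral_solution_value_le mM) _.
by have [] := platform_lower_bound n_gt0 Z_mean Z_var Z_bound C_ge0 C_density
  ZC_indep supp_itv fM.
Qed.

Lemma optimal_mechanism_le M : feasible P theta VAR Z C f M ->
  (platform_cost theta Z C (optimal_mechanism VAR C f ystar)
   <= platform_cost theta Z C M)%E.
Proof.
move=> fM; have [mM _ _] := fM; have vlty := solution_value_lty fM.
rewrite (optimal_platform_cost theta n_gt0 Z_mean Z_var Z_bound C_ge0 C_density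
  ZC_indep supp_itv ystar_meas ystar_sol vlty).
have [le1 _] := platform_lower_bound n_gt0 Z_mean Z_var Z_bound C_ge0 C_density
  ZC_indep supp_itv fM.
by rewrite leeBlDr//; apply: le_trans le1; exact: integral_solution_value_le.
Qed.

(** The gap between the virtual total and the value of the program is nonnegative almost surely, and
    its expectation is at most 0, so it vanishes almost surely. *)
Lemma optimal_is_solution M : feasible P theta VAR Z C f M ->
  (platform_cost theta Z C M
   <= platform_cost theta Z C (optimal_mechanism VAR C f ystar))%E ->
  {ae P, forall w, is_solution VAR (virtual_costs P C f (sens w)) (loss M (sens w)) /\
    forall i, tnth (weight M (sens w)) i =
      tnth (loss M (sens w)) i / \sum_(j < n) tnth (loss M (sens w)) j}.
Proof.
move=> fM; have [mM _ _] := fM; have vlty := solution_value_lty fM.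
have [le1 tlty] := platform_lower_bound n_gt0 Z_mean Z_var Z_bound C_ge0 C_density
  ZC_indep supp_itv fM.
rewrite (optimal_platform_cost theta n_gt0 Z_mean Z_var Z_bound C_ge0 C_density
  ZC_indep supp_itv ystar_meas ystar_sol vlty) leeBrDr// => le2.
have mtot := measurable_virtual_total mM.
have it : P.-integrable setT (EFin \o (fun w => total M (sens w))).
  apply/integrableP; split; first exact/measurable_EFinP.
  by under eq_integral do rewrite /= ger0_norm ?virtual_total_ge0//.
have iv : P.-integrable setT (EFin \o (fun w => value' (sens w))).
  apply/integrableP; split; first exact/measurable_EFinP.
  by under eq_integral do rewrite /= ger0_norm//.
have int0 : (\int[P]_w `|(total M (sens w) - value' (sens w))%:E| = 0)%E.
  transitivity (\int[P]_w ((EFin \o (fun w => total M (sens w))) w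
      - (EFin \o (fun w => value' (sens w))) w))%E.
    apply: ae_eq_integral => //.
    - by apply: measurableT_comp => //; apply/measurable_EFinP; exact: measurable_funB.
    - by apply: emeasurable_funB; exact/measurable_EFinP.
    apply: filterS (sens_supports C_ge0 C_density) => w sw _ /=.
    rewrite -EFinB ger0_norm// subr_ge0 patchE mem_set//.
    by have [] := solution_value_le mM sw.
  rewrite integralB_EFin//; apply/eqP; rewrite eq_le; apply/andP; split.
    rewrite leeBlDr ?add0e; first exact: le_trans le1 le2.
    exact: integrable_fin_num iv.
  rewrite leeBrDr ?add0e; first exact: integral_solution_value_le.
  exact: integrable_fin_num iv.
have ae0 : ae_eq P setT (fun w => (total M (sens w) - value' (sens w))%:E) (cst 0%E).
  apply/ae_eq_integral_abs => //.
  by apply/measurable_EFinP; exact: measurable_funB.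
apply: filterS2 ae0 (density_supports C_ge0 C_density) => w tv Cw.
have sw : supports f (sens w) by move=> i; rewrite tnth_sens; have [] := Cw i.
have [_] := solution_value_le mM sw; apply; last first.
  by move=> i; rewrite tnth_sens; have [] := Cw i.
have [] := tv I; rewrite patchE mem_set// => /eqP.
by rewrite subr_eq0 => /eqP ->.
Qed.

End optimality.

Theorem theorem3 (R : realType) (d : measure_display) (T : measurableType d)
  (P : probability T R) (n : nat) (theta VAR : R)
  (Z C : 'I_n -> {RV P >-> R}) (f : 'I_n -> R -> R)
  (ystar : n.-tuple R -> n.-tuple R)
  (n_gt0 : (0 < n)%N)
  (Z_mean : forall i, ('E_P[Z i] = 0)%E)
  (Z_var : forall i, ('V_P[Z i] = VAR%:E)%E)
  (Z_bound : forall i w, `|Z i w| <= 2^-1)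
  (Z_id : forall i j (A : set R), measurable A ->
    distribution P (Z i) A = distribution P (Z j) A)
  (C_ge0 : forall i w, 0 <= C i w)
  (C_density : forall i, has_density P (C i) (f i))
  (ZC_indep : mutually_independent P
    (fun k : 'I_n + 'I_n => match k with inl i => Z i : T -> R | inr i => C i end))
  (supp_itv : forall i, is_interval (support_of (f i)))
  (virtual_cost_incr : forall i,
    {in support_of (f i) &, {homo virtual_cost P (C i) (f i) : x y / x <= y}})
  (ystar_meas : measurable_fun (supports f)
    (fun c => ystar (virtual_costs P C f c)))
  (ystar_sol : forall c, supports f c ->
    is_solution VAR (virtual_costs P C f c) (ystar (virtual_costs P C f c))) :
  ((exists M, feasible P theta VAR Z C f M) ->
   exists M, optimal_in P theta VAR Z C f setT M /\
     forall c, supports f c -> forall i,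
       let y := ystar (virtual_costs P C f c) in
       tnth (loss M c) i = tnth y i /\
       tnth (weight M c) i = tnth y i / \sum_(j < n) tnth y j) /\
  (forall K M, lossless P theta VAR Z C f K -> optimal_in P theta VAR Z C f K M ->
   {ae P, forall w,
     let c := sensitivities C w in
     let y := loss M c in
     is_solution VAR (virtual_costs P C f c) y /\
     forall i, tnth (weight M c) i = tnth y i / \sum_(j < n) tnth y j}).
Proof.
have opt_feas M : feasible P theta VAR Z C f M ->
    feasible P theta VAR Z C f (optimal_mechanism VAR C f ystar).
  move=> fM; apply: optimal_feasible => //.
  exact: (solution_value_lty n_gt0 Z_mean Z_var Z_bound C_ge0 C_density
    ZC_indep supp_itv ystar_meas ystar_sol fM).
have opt_le M : feasible P theta VAR Z C f M ->
    (platform_cost theta Z C (optimal_mechanism VAR C f ystar)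
     <= platform_cost theta Z C M)%E.
  exact: (optimal_mechanism_le n_gt0 Z_mean Z_var Z_bound C_ge0 C_density
    ZC_indep supp_itv ystar_meas ystar_sol).
split.
  move=> [M0 fM0]; exists (optimal_mechanism VAR C f ystar); split.
    by split => [|//|M' fM' _]; [exact: opt_feas fM0|exact: opt_le].
  by move=> c sc i /=; rewrite !tnth_mktuple mem_set.
move=> K M Kloss [fM KM Mopt].
apply: (optimal_is_solution n_gt0 Z_mean Z_var Z_bound C_ge0 C_density
  ZC_indep supp_itv ystar_meas ystar_sol fM).
(* The explicit optimal mechanism may lie outside [K], but [K] contains feasible mechanisms whose
   cost exceeds its cost by at most [e], for every [e > 0]. *)
apply/lee_addgt0Pr => e e0.
have [M' [fM' KM' M'le]] := Kloss _ e (opt_feas _ fM) e0.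
exact: le_trans (Mopt _ fM' KM') M'le.
Qed.
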